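(* Let $i\ge 2$, $0\le t\le j$ and $m\ge 1$ be integers such that $i+j+t+m$ is even. Then $$a\bigl(m,(i+t,1^{j-t}),(i,1^j)\bigr)=\sum_{s=\max\{0,\,j-i-t+1\}}^{j-t}\frac{(i+j)!}{s!\,(i-j+t+s)}\binom{i-1}{j-s-t}\binom{i+t-1}{j-s}\frac{c(i-j+t+s+1,\,m-s)}{\binom{i-j+t+s+1}{2}}+\Lambda(m,i,j,t),$$ where $$\Lambda(m,i,j,t)=\begin{cases}0&\text{if } i-j+t\ge 1,\\[2pt] \dfrac{(i+j)!}{(j-i-t)!\;i\,(i+t)}\,\delta_{m-j+i+t,\,2}&\text{if } i-j+t\le 0.\end{cases}$$
   Context: For partitions $\lambda,\mu$ of $n$, $a(m,\lambda,\mu)$ is the number of triples $(\sigma,\alpha,\beta)$ of permutations in $\mathfrak{S}_n$ with $\sigma\alpha\beta=e$ (the identity), $\alpha$ of cycle type $\lambda$, $\beta$ of cycle type $\mu$, and $\sigma$ having exactly $m$ cycles (fixed points count as cycles). Here $n=i+j$. $c(N,r)$ is the signless Stirling number of the first kind: the number of permutations of $[N]$ with $r$ cycles (equal to $0$ if $r\le 0$ or $r>N$, for $N\ge 1$). $\delta$ is the Kronecker delta. *)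

(* Defs.v *)
From HB Require Import structures.
From mathcomp Require Import all_boot all_order all_algebra all_fingroup.

Set Implicit Arguments.
Unset Strict Implicit.
Unset Printing Implicit Defensive.

Import GRing.Theory.

Local Open Scope ring_scope.

(* [porbits p] includes the orbits of the fixed points. *)
Definition num_cycles (n : nat) (p : 'S_n) : nat := #|porbits p|.

(* Partitions are represented by the nonincreasing sequence of their parts. *)
Definition cycle_type (n : nat) (p : 'S_n) : seq nat :=
  sort geq [seq #|(C : {set _})| | C <- enum (porbits p)].

(* In MathComp [(s * a) x = a (s x)]; the count does not depend on whether
   products are composed from left to right or from right to left, since
   reversing the order replaces [s = (a * b)^-1] by a conjugate. *)
Definition num_triples (n m : nat) (la mu : seq nat) : nat :=
  #|[set x : 'S_n * 'S_n * 'S_n |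
     let: (s, a, b) := x in
     [&& (s * a * b == 1)%g, cycle_type a == la, cycle_type b == mu
       & num_cycles s == m]]|.

(* The second argument is an integer, as it may be negative. *)
Definition stirling1 (N : nat) (r : int) : nat :=
  #|[set p : 'S_N | (num_cycles p)%:Z == r]|.

(* The condition [j < i + t] is i - j + t >= 1; in the other case the
   truncated subtraction [j - (i + t)] is exact. *)
Definition Lambda (m i j t : nat) : rat :=
  if (j < i + t)%N then 0
  else ((i + j)`!)%N%:R / ((j - (i + t))`! * i * (i + t))%N%:R
       * (m%:Z - j%:Z + i%:Z + t%:Z == 2)%:R.

(* Main.v *)
(* Two cycles [a] and [b] on supports [A] and [B]: deleting a point of
   [A :\: B] from the cycle [a], by multiplying [a] with a transposition, does
   not merge or split the other cycles of [a * b].  This reduces the count to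
   pairs of full cycles on [k = #|A :&: B|] points (or, for disjoint supports,
   to nothing), and shows as well that pairs of [k]-cycles on [k] points
   correspond to pairs made of a [k+1]-cycle and a [k]-cycle on [k+1] points.
   By a theorem of Boccara every odd permutation of [k+1] points is a product
   of such a pair in exactly [2 (k-1)!] ways, whatever its cycle type; hence
   the Stirling number.

   For Boccara's theorem, [g] is a full cycle iff the signed sum, over the
   [g]-stable sets [U] avoiding a given point, of [(-1)^(number of cycles of g
   in U)] is [1]; otherwise that sum is [0].  Summing over [g = b * s] with [b]
   ranging over the [k]-cycles, the terms with [2 <= #|U| <= k-1] cancel by a
   sign-reversing involution, and those with [#|U|] equal to [0], [1] or [k]
   are counted directly. *)
Require Import Defs.
From HB Require Import structures.
From mathcomp Require Import all_boot all_order all_algebra all_fingroup.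
From mathcomp Require Import zify ring.

Set Implicit Arguments.
Unset Strict Implicit.
Unset Printing Implicit Defensive.

Import GRing.Theory.

Local Open Scope ring_scope.

(** * Cycle counts, and full cycles on a subset *)

Section CycleCounts.
Local Open Scope nat_scope.
Local Open Scope group_scope.
Variable T : finType.
Implicit Types (g h a b : {perm T}) (A B U : {set T}) (x y z : T).

Lemma porbit_intertwine (T' : finType) (f : T -> T') (g : {perm T})
    (g' : {perm T'}) (x : T) :
  (forall y, g' (f y) = f (g y)) -> porbit g' (f x) = f @: porbit g x.
Proof.
move=> fE; have fX i y : (g' ^+ i) (f y) = f ((g ^+ i) y).
  by elim: i y => [|i IH] y; rewrite ?perm1 // !expgS !permM fE IH.
apply/setP=> z; apply/porbitP/imsetP => [[i ->]|[y /porbitP [i ->] ->]].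
  by exists ((g ^+ i) x); rewrite ?mem_porbit.
by exists i.
Qed.

Lemma card_porbitsJ g h : #|porbits (g ^ h)| = #|porbits g|.
Proof.
have -> : porbits (g ^ h) = (fun C : {set T} => h @: C) @: porbits g.
  apply/setP=> C; apply/imsetP/imsetP => [[x _ ->]|[_ /imsetP [x _ ->] ->]].
    exists (porbit g (h^-1 x)); first exact: imset_f.
    by rewrite -(@porbit_intertwine _ h g (g ^ h)) ?permKV // => y; rewrite permJ.
  exists (h x) => //.
  by rewrite -(@porbit_intertwine _ h g (g ^ h)) // => y; rewrite permJ.
by rewrite card_imset //; apply: imset_inj; exact: perm_inj.
Qed.

Lemma card_porbitsC g h : #|porbits (g * h)| = #|porbits (h * g)|.
Proof. by rewrite -(card_porbitsJ (g * h) g) conjgE !mulgA mulVg mul1g. Qed.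

Lemma card_porbits_join g x y :
  x \notin porbit g y -> #|porbits (tperm x y * g)|.+1 = #|porbits g|.
Proof.
move=> xNy; have := porbits_mul_tperm g x y; rewrite /= xNy.
have -> : x != y by apply: contraNneq xNy => ->; exact: porbit_id.
by lia.
Qed.

Lemma card_porbits_split g x y :
  x != y -> x \in porbit g y -> #|porbits (tperm x y * g)| = #|porbits g|.+1.
Proof.
move=> xy xIy; have := porbits_mul_tperm g x y; rewrite /= xIy xy.
by lia.
Qed.

Lemma porbit_fix g x : g x = x -> porbit g x = [set x].
Proof.
move=> gx; apply/setP=> y; rewrite inE; apply/porbitP/eqP => [[i ->]|->].
  by elim: i => [|i IH]; rewrite ?perm1 // expgSr permM IH.
by exists 0%N; rewrite perm1.
Qed.

Lemma porbit_subset g A x :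
  (forall y, (g y \in A) = (y \in A)) -> (porbit g x \subset A) = (x \in A).
Proof.
move=> gA; apply/subsetP/idP => [|xA y /porbitP [i ->]].
  by apply; exact: porbit_id.
by elim: i => [|i IH]; rewrite ?perm1 // expgSr permM gA.
Qed.

(** Every point outside [A] is a cycle by itself, so the orbits not contained in [A] correspond to
    the points of the complement. The equation is additive to avoid truncated subtraction. *)
Lemma card_porbits_on A g : perm_on A g ->
  #|porbits g| + #|A| = #|T| + #|[set C in porbits g | C \subset A]|.
Proof.
move=> gA; rewrite -(cardsID [set C : {set T} | C \subset A] (porbits g)).
have -> : porbits g :\: [set C : {set T} | C \subset A] = set1 @: ~: A.
  apply/setP=> C; rewrite !inE; apply/andP/imsetP.
    case=> CA /imsetP [x _ CE]; move: CA; rewrite CE.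
    rewrite (porbit_subset _ (fun y => perm_closed y gA)) => xA.
    by exists x; rewrite ?inE // porbit_fix // (out_perm gA).
  case=> x; rewrite inE => xA ->.
  have gx : porbit g x = [set x] by rewrite porbit_fix // (out_perm gA).
  split; first by rewrite sub1set.
  by rewrite -gx imset_f.
rewrite card_imset; last exact: set1_inj.
rewrite -(cardsC A).
have -> : porbits g :&: [set C : {set T} | C \subset A] =
         [set C in porbits g | C \subset A] by apply/setP=> C; rewrite !inE.
lia.
Qed.

(* A singleton carries exactly one cycle, the identity. *)
Definition cyclic_on A g := perm_on A g && (#|porbits g| + #|A| == #|T|.+1).

Lemma card_porbits_on_ge A x g :
  perm_on A g -> x \in A -> #|T| < #|porbits g| + #|A|.
Proof.
move=> gA xA; rewrite (card_porbits_on gA) -addn1 leq_add2l card_gt0.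
apply/set0Pn; exists (porbit g x).
by rewrite inE imset_f //= (porbit_subset _ (fun y => perm_closed y gA)).
Qed.

(** By [card_porbits_on], the count in [cyclic_on] leaves exactly one orbit inside [A]. *)
Lemma cyclic_on_porbit A g x : cyclic_on A g -> x \in A -> porbit g x = A.
Proof.
case/andP=> gA /eqP gn xA; have clA y := perm_closed y gA.
have := card_porbits_on gA; rewrite gn -addn1 => /addnI /esym/eqP/cards1P [C CE].
have subC y : y \in A -> porbit g y = C.
  move=> yA; apply/set1P; rewrite -CE inE imset_f //=.
  by rewrite porbit_subset.
apply/eqP; rewrite eqEsubset porbit_subset // xA /=.
by apply/subsetP=> y yA; rewrite (subC x xA) -(subC y yA) porbit_id.
Qed.

Lemma card_porbits1_porbit g x : #|porbits g| = 1%N -> porbit g x = setT.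
Proof.
move=> g1; apply: (@cyclic_on_porbit setT); rewrite ?inE //.
by rewrite /cyclic_on g1 cardsT eqxx andbT; apply/subsetP=> y; rewrite inE.
Qed.

Lemma perm_on_tpermM A g x y : x \in A -> y \in A ->
  perm_on A (tperm x y * g) = perm_on A g.
Proof.
move=> xA yA; have tA : perm_on A (tperm x y).
  apply: subset_trans (tperm_on x y) _.
  by apply/subsetP=> z /set2P [] ->.
apply/idP/idP => gA; last exact: perm_onM.
by rewrite -(mulKg (tperm x y) g) tpermV perm_onM.
Qed.

Lemma perm_onD1 A g x : perm_on (A :\ x) g = perm_on A g && (g x == x).
Proof.
apply/idP/andP => [gA|[/subsetP gA gx]].
  split; last by rewrite (out_perm gA) // !inE eqxx.
  by apply: subset_trans gA _; exact: subD1set.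
apply/subsetP=> y yg; rewrite !inE gA // andbT.
by apply: contraTneq yg => ->; rewrite inE negbK.
Qed.

(** Left multiplication by [tperm x y] inserts the fixed point [x] into the cycle right after [y],
    which joins two orbits. *)
Lemma cyclic_on_extend A g x y : x \in A -> y \in A :\ x ->
  cyclic_on (A :\ x) g -> cyclic_on A (tperm x y * g).
Proof.
move=> xA; rewrite !inE => /andP [yx yA] /andP [].
rewrite perm_onD1 => /andP [gA /eqP gx] /eqP gn; apply/andP; split.
  by rewrite perm_on_tpermM.
have : y \notin porbit g x by rewrite porbit_fix // inE.
rewrite porbit_sym => /card_porbits_join.
move: gn; rewrite (cardsD1 x A) xA; lia.
Qed.

(** The inverse of [cyclic_on_extend]: the predecessor of [x] is sent directly to the successor of
    [x], and [x] splits off as a fixed point. *)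
Lemma cyclic_on_contract A g x : x \in A -> A != [set x] -> cyclic_on A g ->
  (g^-1 x \in A :\ x) && cyclic_on (A :\ x) (tperm x (g^-1 x) * g).
Proof.
move=> xA A1 gcyc; have [y yA yx] : exists2 y, y \in A & y != x.
  have /set0Pn [y] : A :\ x != set0.
    by apply: contra A1 => /eqP A0; rewrite -(setD1K xA) A0 setU0.
  by rewrite !inE => /andP [yx yA]; exists y.
have [gA /eqP gn] := andP gcyc.
have gx : g^-1 x != x.
  apply: contra yx => /eqP gx; have : y \in porbit g x by rewrite (cyclic_on_porbit gcyc).
  by rewrite porbit_fix ?inE // -{1}gx permKV.
have gxA : g^-1 x \in A by rewrite perm_closed // perm_onV.
rewrite !inE gx gxA /= /cyclic_on perm_onD1 perm_on_tpermM // gA /=.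
rewrite permM tpermL permKV eqxx /=.
rewrite card_porbits_split 1?eq_sym //; last by rewrite (cyclic_on_porbit gcyc).
by rewrite addSnnS -gn (cardsD1 x A) xA; lia.
Qed.

End CycleCounts.

(** * Sums over full cycles, and deletion of points lying in only one support *)

Section CyclicSums.
Local Open Scope nat_scope.
Local Open Scope group_scope.
Variable T : finType.
Implicit Types (g h a b : {perm T}) (A B X : {set T}) (x y z : T).

(** A full cycle on [A] amounts to the predecessor [y] of [x] together with the cycle left after
    deleting [x]. *)
Lemma sum_cyclic_onD1 A x (F : {perm T} -> nat) : x \in A -> A != [set x] ->
  \sum_(a | cyclic_on A a) F a =
   \sum_(y in A :\ x) \sum_(a | cyclic_on (A :\ x) a) F (tperm x y * a)%g.
Proof.
move=> xA A1.
rewrite (partition_big (fun a => a^-1 x) (mem (A :\ x))) /=; last first.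
  by move=> a acyc; case/andP: (cyclic_on_contract xA A1 acyc).
apply: eq_bigr => y yA.
rewrite (reindex_onto (mulg (tperm x y)) (mulg (tperm x y))) /=; last first.
  by move=> a _; rewrite tpermKg.
apply: eq_bigl => a; rewrite tpermKg eqxx andbT.
apply/andP/idP => [[acyc /eqP ay]|acyc].
  by case/andP: (cyclic_on_contract xA A1 acyc) => _; rewrite ay tpermKg.
split; first exact: cyclic_on_extend.
have ax : a x = x by move: acyc => /andP []; rewrite perm_onD1 => /andP [_ /eqP].
have aVx : a^-1 x = x by rewrite -{1}ax permK.
by rewrite invMg permM aVx tpermV tpermL.
Qed.

Lemma cyclic_on1 x a : cyclic_on [set x] a = (a == 1).
Proof.
apply/idP/eqP => [/andP [ax _]|->]; first by apply: (perm_on_id ax); rewrite cards1.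
rewrite /cyclic_on perm_on1 cards1 addn1 eqSS /porbits card_imset ?eqxx //.
by move=> y z; rewrite !porbit_fix ?perm1 //; exact: set1_inj.
Qed.

Lemma card_cyclic_on A : A != set0 -> \sum_(a | cyclic_on A a) 1 = (#|A|.-1)`!.
Proof.
have [n] := ubnP #|A|; elim: n A => // n IH A /[!ltnS] An /set0Pn [x xA].
have [->|A1] := eqVneq A [set x].
  by rewrite (eq_bigl _ _ (cyclic_on1 x)) big_pred1_eq cards1.
rewrite (sum_cyclic_onD1 _ xA A1) /= sum_nat_const.
have AD := cardsD1 x A; rewrite xA in AD.
have A'0 : A :\ x != set0.
  by apply: contra A1 => /eqP A0; rewrite -(setD1K xA) A0 setU0.
rewrite IH //; last by lia.
by move: A'0; rewrite -card_gt0 AD; case: #|A :\ x| => // m _; rewrite add1n /= factS.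
Qed.

Definition cyclic_pairs A B c : nat :=
  \sum_(a | cyclic_on A a) \sum_(b | cyclic_on B b) (#|porbits (a * b)%g| == c).

Lemma cyclic_pairsC A B c : cyclic_pairs A B c = cyclic_pairs B A c.
Proof.
rewrite /cyclic_pairs exchange_big /=; apply: eq_bigr => b _.
by apply: eq_bigr => a _; rewrite card_porbitsC.
Qed.

(** After the deletion both factors fix [x], so putting [x] back merges a fixed point of the product
    into another cycle. The [#|A|.-1] choices are those of the predecessor of [x]. *)
Lemma cyclic_pairsD1 A B x c : x \in A -> A != [set x] -> x \notin B ->
  cyclic_pairs A B c = (#|A|.-1 * cyclic_pairs (A :\ x) B c.+1)%N.
Proof.
move=> xA A1 xB; rewrite {1}/cyclic_pairs (sum_cyclic_onD1 _ xA A1).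
have -> : #|A|.-1 = #|A :\ x| by rewrite (cardsD1 x A) xA.
rewrite -sum_nat_const; apply: eq_bigr => y /setD1P [yx yA].
apply: eq_bigr => a /andP []; rewrite perm_onD1 => /andP [_ /eqP ax] _.
apply: eq_bigr => b /andP [bB _]; congr (nat_of_bool _).
rewrite -mulgA -eqSS; congr (_ == _); apply: card_porbits_join.
by rewrite porbit_sym porbit_fix ?inE // permM ax (out_perm bB).
Qed.

(** Iterates [cyclic_pairsD1] over the points of [A :\: X]. Each deletion raises the cycle count by
    one, and the factors multiply to a quotient of factorials, whose denominator is moved to the
    left. *)
Lemma cyclic_pairs_reduce X A B c :
  X != set0 -> X \subset A -> [disjoint A :\: X & B] ->
  (cyclic_pairs A B c * (#|X|.-1)`! =
   (#|A|.-1)`! * cyclic_pairs X B (c + (#|A| - #|X|)))%N.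
Proof.
move=> X0; have [n] := ubnP #|A|; elim: n A c => // n IH A c /[!ltnS] An XA dAB.
have [AX|/set0Pn [x]] := eqVneq (A :\: X) set0.
  have -> : A = X by apply/eqP; rewrite eqEsubset XA -setD_eq0 AX eqxx.
  by rewrite subnn addn0 mulnC.
case/setDP=> xA xX.
have xB : x \notin B.
  by apply: (contraTN _ dAB) => xB; apply/pred0Pn; exists x; rewrite /= !inE xX xA xB.
have XA' : X \subset A :\ x by rewrite subsetD1 XA xX.
have A1 : A != [set x].
  apply: contraNneq xX => A1; move: XA X0; rewrite A1 subset1.
  by case/orP=> /eqP ->; rewrite ?set11 // eqxx.
have AD := cardsD1 x A; rewrite xA in AD.
rewrite (cyclic_pairsD1 _ xA A1 xB) -mulnA IH //; first last.
- apply: disjointWl dAB; apply/subsetP=> z; rewrite !inE.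
  by case/and3P=> -> _ ->.
- by lia.
have := subset_leq_card XA'; move: X0; rewrite -card_gt0 AD add1n /= => X0 le.
have -> : (#|A :\ x|)`! = (#|A :\ x| * (#|A :\ x|.-1)`!)%N.
  by move: (leq_trans X0 le); case: #|A :\ x| => // m _; rewrite factS.
by rewrite -mulnA; congr (_ * (_ * cyclic_pairs _ _ _))%N; lia.
Qed.

End CyclicSums.

(** * Extension of permutations along an injection *)

Section Transfer.
Local Open Scope nat_scope.
Local Open Scope group_scope.
Variables (T T' : finType) (f : T -> T').
Hypothesis f_inj : injective f.

Definition perm_extend_fun (g : {perm T}) (y : T') : T' :=
  if [pick x | f x == y] is Some x then f (g x) else y.

Lemma perm_extend_fun_in (g : {perm T}) x : perm_extend_fun g (f x) = f (g x).
Proof.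
rewrite /perm_extend_fun; case: pickP => [z /eqP /f_inj -> //|/(_ x)].
by rewrite eqxx.
Qed.

Lemma perm_extend_fun_out (g : {perm T}) y :
  y \notin codom f -> perm_extend_fun g y = y.
Proof.
rewrite /perm_extend_fun; case: pickP => // z /eqP <-.
by rewrite codom_f.
Qed.

Lemma perm_extend_subproof (g : {perm T}) : injective (perm_extend_fun g).
Proof.
apply: (can_inj (g := perm_extend_fun g^-1)) => y.
have [/codomP [x ->]|yf] := boolP (y \in codom f).
  by rewrite !perm_extend_fun_in permK.
by rewrite !perm_extend_fun_out.
Qed.

Definition perm_extend (g : {perm T}) : {perm T'} := perm (@perm_extend_subproof g).

Lemma perm_extend_in (g : {perm T}) x : perm_extend g (f x) = f (g x).
Proof. by rewrite permE perm_extend_fun_in. Qed.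

Lemma perm_extend_out (g : {perm T}) y : y \notin codom f -> perm_extend g y = y.
Proof. by move=> yf; rewrite permE perm_extend_fun_out. Qed.

Lemma perm_extendM (g h : {perm T}) :
  perm_extend (g * h) = perm_extend g * perm_extend h.
Proof.
apply/permP=> y; rewrite permM.
have [/codomP [x ->]|yf] := boolP (y \in codom f).
  by rewrite !perm_extend_in permM.
by rewrite !perm_extend_out.
Qed.

Lemma perm_extend_inj : injective perm_extend.
Proof.
move=> g h gh; apply/permP=> x; apply: f_inj.
by rewrite -!perm_extend_in gh.
Qed.

Lemma perm_extend_on (g : {perm T}) : perm_on (f @: setT) (perm_extend g).
Proof.
apply/subsetP=> y; rewrite inE; apply: contraR => yf.
rewrite perm_extend_out //; apply: contra yf => /codomP [x ->].
exact: imset_f.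
Qed.

Lemma perm_extend_onto (k : {perm T'}) :
  perm_on (f @: setT) k -> exists g, k = perm_extend g.
Proof.
(* The default [x] is never reached, because [k] preserves the image of [f]. *)
move=> kf; pose k' x := odflt x [pick z | f z == k (f x)].
have k'E x : f (k' x) = k (f x).
  rewrite /k'; case: pickP => [z /eqP //|kx].
  have : k (f x) \in f @: setT by rewrite perm_closed // imset_f.
  by case/imsetP=> z _ kz; move: (kx z); rewrite kz eqxx.
have k'_inj : injective k'.
  by move=> x z /(congr1 f); rewrite !k'E => /perm_inj /f_inj.
exists (perm k'_inj); apply/permP=> y.
have [/codomP [x ->]|yf] := boolP (y \in codom f).
  by rewrite perm_extend_in permE k'E.
rewrite perm_extend_out // (out_perm kf) //.
by apply: contra yf => /imsetP [x _ ->]; exact: codom_f.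
Qed.

Lemma card_porbits_extend (g : {perm T}) :
  #|porbits (perm_extend g)| + #|T| = #|porbits g| + #|T'|.
Proof.
have := card_porbits_on (perm_extend_on g).
rewrite card_imset // cardsT => ->; rewrite addnC; congr (_ + _).
have -> : [set C in porbits (perm_extend g) | C \subset f @: [set: T]]
  = (fun C : {set T} => f @: C) @: porbits g.
  apply/setP=> C; rewrite inE.
  have EI x := @porbit_intertwine _ _ f g (perm_extend g) x (perm_extend_in g).
  apply/andP/imsetP => [[/imsetP [y _ ->]]|[_ /imsetP [x _ ->] ->]].
    rewrite porbit_subset; last by move=> z; rewrite perm_closed ?perm_extend_on.
    by case/imsetP=> x _ ->; exists (porbit g x); [exact: imset_f | exact: EI].
  by split; [rewrite -EI; exact: imset_f | apply: imsetS; exact: subsetT].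
by rewrite card_imset //; exact: imset_inj.
Qed.

Lemma cyclic_on_extendE (g : {perm T}) :
  cyclic_on (f @: setT) (perm_extend g) = cyclic_on setT g.
Proof.
rewrite /cyclic_on perm_extend_on card_imset //= cardsT card_porbits_extend.
have -> : perm_on setT g by apply/subsetP=> x; rewrite inE.
by rewrite -addn1 addnC -[#|T|.+1]addn1 [_ + #|T|]addnC !eqn_add2l.
Qed.

(** The points outside the image are fixed by both cycles, so they add [#|T'| - #|T|] cycles to the
    product. *)
Lemma cyclic_pairs_transfer c c' : c' + #|T| = c + #|T'| ->
  cyclic_pairs (f @: setT) (f @: setT) c' = cyclic_pairs [set: T] [set: T] c.
Proof.
move=> cE.
have S (F : {perm T'} -> nat) : \sum_(a | cyclic_on (f @: setT) a) F a
   = \sum_(a | cyclic_on [set: T] a) F (perm_extend a).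
  rewrite -(big_imset (h := perm_extend)) /=; last by move=> ? ? _ _ /perm_extend_inj.
  apply: eq_bigl => a; apply/idP/imsetP => [acyc|[g gcyc ->]].
    have [g ag] := perm_extend_onto (proj1 (andP acyc)).
    by exists g => //; move: acyc; rewrite ag cyclic_on_extendE.
  by rewrite cyclic_on_extendE.
rewrite /cyclic_pairs S; apply: eq_bigr => a _; rewrite S; apply: eq_bigr => b _.
congr (nat_of_bool _); rewrite -perm_extendM.
by rewrite -(eqn_add2r #|T|) card_porbits_extend cE eqn_add2r.
Qed.

End Transfer.

(** * Signed sums over the stable sets of a permutation *)

Lemma sum_sign_reversing (I : finType) (P : pred I) (F : I -> int) (phi : I -> I) :
    (forall x, P x -> P (phi x)) -> (forall x, P x -> phi (phi x) = x) ->
    (forall x, P x -> F (phi x) = - F x) ->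
  \sum_(x | P x) F x = 0.
Proof.
move=> phiP phiK phiF; set S := \sum_(x | P x) F x.
have : S = - S.
  rewrite {1}/S (reindex_onto phi phi) //= /S -sumrN.
  have PE x : P (phi x) && (phi (phi x) == x) = P x.
    apply/andP/idP => [[Px /eqP <-]|Px]; first exact: phiP.
    by split; [exact: phiP | rewrite phiK].
  by rewrite (eq_bigl _ _ PE); exact: eq_bigr.
lia.
Qed.

Section StableSets.
Local Open Scope group_scope.
Variable T : finType.
Implicit Types (g h a b s : {perm T}) (A B U : {set T}) (x y z p : T).

Lemma perm_stabP U g :
  reflect (forall x, (g x \in U) = (x \in U)) (g \in 'N(U | 'P)).
Proof.
apply: (iffP idP) => [gU x|gU]; first exact: (astabsP gU).
rewrite !inE; apply/subsetP=> x xU; rewrite inE /= apermE gU //.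
Qed.

Definition porbits_in U g := [set C in porbits g | C \subset U].

Definition stab_sign U g : int := ((-1) ^+ #|porbits_in U g|)%R.

Lemma mem_porbits_in U g x : g \in 'N(U | 'P) ->
  (porbit g x \in porbits_in U g) = (x \in U).
Proof.
by move/perm_stabP=> gU; rewrite inE imset_f //= porbit_subset.
Qed.

Lemma card_porbits_in_toggle U g x : g \in 'N(U | 'P) -> x \notin U ->
  #|porbits_in (U :|: porbit g x) g| = #|porbits_in U g|.+1.
Proof.
move=> gU xU; rewrite (cardsD1 (porbit g x)).
have gP := perm_stabP _ _ gU.
have gUx : g \in 'N(U :|: porbit g x | 'P).
  apply/perm_stabP=> y; rewrite !inE gP; congr (_ || _).
  by rewrite -!eq_porbit_mem (porbit_perm g 1).
rewrite mem_porbits_in // !inE porbit_id orbT add1n; congr _.+1; apply: eq_card => C.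
rewrite !inE; case: imsetP => [[y _ ->]|]; rewrite ?andbF //=.
rewrite !porbit_subset //; last exact/perm_stabP.
rewrite eq_porbit_mem !inE; have [yx|//] /= := boolP (y \in porbit g x); last by rewrite orbF.
apply/esym/negbTE; apply: contra xU; rewrite -(porbit_subset y gP) => /subsetP; apply.
by rewrite porbit_sym.
Qed.

(* The sum factors as a product of [1 - 1] over the cycles avoiding [p]. *)
Lemma sum_stab_sign p g :
  \sum_(U : {set T} | (p \notin U) && (g \in 'N(U | 'P))) stab_sign U g
  = (#|porbits g| == 1%N)%:R.
Proof.
have [g1|g1] := eqVneq #|porbits g| 1%N.
  rewrite (big_pred1 set0) => [|U].
    rewrite /stab_sign (_ : porbits_in set0 g = set0) ?cards0 //.
    apply/setP=> C; rewrite !inE; case: imsetP => // -[y _ ->] /=.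
    by rewrite porbit_subset ?inE // => z; rewrite !inE.
  apply/andP/eqP => [[pU gU]|->].
    apply/setP=> x; rewrite inE; apply: contraNF pU => xU.
    have := mem_porbits_in x gU; rewrite xU inE (card_porbits1_porbit x g1).
    by case/andP=> _ /subsetP; apply; rewrite inE.
  by rewrite inE; split => //; apply/perm_stabP=> x; rewrite !inE.
have [x px] : exists x, x \notin porbit g p.
  apply/existsP; rewrite -negb_forall; apply: contra g1 => /forallP gp.
  apply/cards1P; exists (porbit g p); apply/setP=> C; rewrite inE.
  apply/imsetP/eqP => [[y _ ->]|->]; last by exists p.
  by apply/eqP; rewrite eq_porbit_mem.
(* The cancellation comes from toggling this one cycle. It avoids [p], a stable set contains all of
   it or none of it, and toggling changes the number of cycles in the set by one. *)
set C := porbit g x.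
have gC y : (g y \in C) = (y \in C).
  by rewrite -!eq_porbit_mem (porbit_perm g 1).
have memC U y : g \in 'N(U | 'P) -> y \in C -> (y \in U) = (x \in U).
  move=> gU; rewrite -eq_porbit_mem => /eqP yC.
  by rewrite -!(mem_porbits_in _ gU) yC.
have pC : p \in C = false by apply/negbTE; rewrite porbit_sym.
have xC : x \in C by exact: porbit_id.
apply: (sum_sign_reversing (phi := fun U => if x \in U then U :\: C else U :|: C)).
- move=> U /andP [pU gU] /=; have gP := elimT (perm_stabP _ _) gU.
  have UC : g \in 'N(U :\: C | 'P) by apply/perm_stabP=> y; rewrite !in_setD gC gP.
  have UC' : g \in 'N(U :|: C | 'P) by apply/perm_stabP=> y; rewrite !in_setU gC gP.
  by case: ifP => xU; rewrite ?UC ?UC' andbT !inE (negbTE pU) ?andbF ?pC.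
- move=> U /andP [_ gU] /=; case: (boolP (x \in U)) => xU; rewrite !inE xC ?orbT /=.
    apply/setP=> y; rewrite !inE; case: (boolP (y \in C)) => //= yC; last by rewrite orbF.
    by rewrite (memC U) // ?xU ?(negbTE xU).
  apply/setP=> y; rewrite !inE; case: (boolP (y \in C)) => //= yC; last by rewrite orbF.
  by rewrite (memC U) // ?xU ?(negbTE xU).
- move=> U /andP [_ gU]; have gP := elimT (perm_stabP _ _) gU.
  rewrite /stab_sign /=; case: (boolP (x \in U)) => xU; last first.
    by rewrite card_porbits_in_toggle // exprS mulN1r.
  have gUC : g \in 'N(U :\: C | 'P) by apply/perm_stabP=> y; rewrite !inE gC gP.
  have -> : porbits_in U g = porbits_in ((U :\: C) :|: C) g.
    congr (porbits_in _ g); apply/setP=> y; rewrite !inE.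
    case: (boolP (y \in C)) => //= yC; last by rewrite orbF.
    by rewrite (memC U) // ?xU ?(negbTE xU).
  have xUC : x \notin U :\: C by rewrite inE xC.
  by rewrite card_porbits_in_toggle // exprS mulN1r opprK.
Qed.

(** The cycles of [g] inside [U] are those of its restriction to [U], and the sign of a permutation
    is the parity of the number of points plus the number of cycles. Hence multiplication by a
    stabilizer of [U] changes [stab_sign] by the sign of its restriction. *)
Lemma odd_porbits_in U g : g \in 'N(U | 'P) ->
  odd #|porbits_in U g| = odd #|U| (+) odd_perm (restr_perm U g).
Proof.
move=> gU; have rU := restr_perm_on U g.
have gP := elimT (perm_stabP _ _) gU.
have E x : x \in U -> porbit (restr_perm U g) x = porbit g x.
  move=> xU; have X i : (restr_perm U g ^+ i) x = (g ^+ i) x /\ (g ^+ i) x \in U.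
    elim: i => [|i [IH1 IH2]]; first by rewrite !perm1.
    by rewrite !expgSr !permM IH1 restr_permE // gP.
  by apply/setP=> y; apply/porbitP/porbitP => -[i ->]; exists i; case: (X i).
have -> : porbits_in U g = porbits_in U (restr_perm U g).
  apply/setP=> C; rewrite !inE; apply/andP/andP => -[/imsetP [x _ ->]].
    rewrite porbit_subset // => xU; split=> //.
    by rewrite -E // imset_f.
  rewrite porbit_subset; last by move=> y; rewrite perm_closed.
  by move=> xU; split; rewrite ?porbit_subset // E // imset_f.
have := congr1 odd (card_porbits_on rU); rewrite !oddD /odd_perm -/(porbits_in U _).
by case: (odd _); case: (odd _); case: (odd _); case: (odd _).
Qed.

Lemma stab_signM U g h : g \in 'N(U | 'P) -> h \in 'N(U | 'P) ->
  stab_sign U (g * h) = ((-1) ^+ odd_perm (restr_perm U g) * stab_sign U h)%R.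
Proof.
move=> gU hU; rewrite /stab_sign -signr_odd -(signr_odd _ #|porbits_in U h|) !odd_porbits_in ?groupM //.
rewrite morphM //= odd_permM -signr_addb.
by rewrite addbCA.
Qed.

Lemma stab_signMr U g h : g \in 'N(U | 'P) -> h \in 'N(U | 'P) ->
  stab_sign U (g * h) = (stab_sign U g * (-1) ^+ odd_perm (restr_perm U h))%R.
Proof.
move=> gU hU; rewrite /stab_sign -signr_odd -(signr_odd _ #|porbits_in U g|) !odd_porbits_in ?groupM //.
by rewrite morphM //= odd_permM -signr_addb addbA.
Qed.

Lemma tperm_stab U x y : (x \in U) = (y \in U) -> tperm x y \in 'N(U | 'P).
Proof.
by move=> xy; apply/perm_stabP=> z; case: tpermP => // ->.
Qed.

(** The source of the signs in the involutions below: a transposition of two points of [U] flips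
    [stab_sign], one of two points of the complement preserves it. *)
Lemma odd_restr_tperm U x y : (x \in U) = (y \in U) ->
  odd_perm (restr_perm U (tperm x y)) = (x \in U) && (x != y).
Proof.
move=> xy; have tU := tperm_stab xy; have rU := restr_perm_on U (tperm x y).
have [xU|xU] /= := boolP (x \in U).
  suff -> : restr_perm U (tperm x y) = tperm x y by rewrite odd_tperm.
  apply/permP=> z; have [zU|zU] := boolP (z \in U); first by rewrite restr_permE.
  rewrite (out_perm rU) // tpermD //; apply: contraNneq zU => <- //.
  by rewrite -xy.
suff -> : restr_perm U (tperm x y) = 1 by rewrite odd_perm1.
apply/permP=> z; rewrite perm1; have [zU|zU] := boolP (z \in U).
  rewrite restr_permE // tpermD //; apply: contraTneq zU => <- //.
  by rewrite -xy.
by rewrite (out_perm rU).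
Qed.

End StableSets.

(** * Boccara's theorem on products of two long cycles *)

Section Boccara.
Local Open Scope group_scope.
Variable T : finType.
Implicit Types (g h a b s : {perm T}) (A B U V : {set T}) (x y z p e : T).

Lemma cyclic_onC1 e g :
  cyclic_on [set~ e] g = (g e == e) && (#|porbits g| == 2%N).
Proof.
have -> : [set~ e] = setT :\ e by apply/setP=> x; rewrite !inE andbT.
rewrite /cyclic_on perm_onD1.
have -> : perm_on setT g by apply/subsetP=> x; rewrite inE.
have := cardsD1 e setT; rewrite inE cardsT /= => ->; congr (_ && _).
by rewrite add1n -[X in _ == X]add2n eqn_add2r.
Qed.

Lemma cyclic_onC1_stable e g U x : cyclic_on [set~ e] g ->
  (forall y, y \in U -> g y \in U) -> x \in U -> x != e -> [set~ e] \subset U.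
Proof.
move=> gcyc gU xU xe; have xC : x \in [set~ e] by rewrite !inE.
rewrite -(cyclic_on_porbit gcyc xC); apply/subsetP=> y /porbitP [i ->].
by elim: i => [|i IH]; rewrite ?perm1 // expgSr permM gU.
Qed.

Section Cancel.
Variables (s : {perm T}) (U : {set T}).
(** The set [U] is stable under [b * s] exactly when [b] maps [U] onto [V]. The cancellation depends
    on the size of [U :\: V], with the cases 0, 1 and at least 2. *)
Let V := [set x | s x \in U].

Let card_V : #|V| = #|U|.
Proof.
have -> : V = s @^-1: U by apply/setP=> x; rewrite !inE.
by rewrite card_preimset //; exact: perm_inj.
Qed.

Let stabE b : (b * s \in 'N(U | 'P)) -> forall x, (b x \in V) = (x \in U).
Proof. by move/perm_stabP=> bU x; rewrite -bU permM inE. Qed.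

Let summand (eb : T * {perm T}) :=
  cyclic_on [set~ eb.1] eb.2 && (eb.2 * s \in 'N(U | 'P)).

(** The sum is empty: [b] would stabilize [U], which contains a point other than [e] and hence all
    [#|T| - 1] points of the cycle. *)
Let sum_eq : (2 <= #|U|)%N -> (#|U| + 2 <= #|T|)%N -> V = U ->
  \sum_(eb | summand eb) stab_sign U (eb.2 * s) = 0.
Proof.
move=> U2 Un VU; apply: big_pred0 => -[e b]; apply/negP=> /andP [/= bcyc].
move/stabE; rewrite VU => bU.
have [x xU xe] : exists2 x, x \in U & x != e.
  have /card_gt0P [x] : (0 < #|U :\ e|)%N by have := cardsD1 e U; lia.
  by rewrite !inE => /andP [xe xU]; exists x.
have bU' y : y \in U -> b y \in U by rewrite bU.
have := subset_leq_card (cyclic_onC1_stable bcyc bU' xU xe).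
by rewrite cardsC1; lia.
Qed.

(** The involution conjugates [b] by [r = tperm x y], which turns [b * s] into
    [r * (b * s) * r ^ s]. The factor [r] acts inside [U] and flips the sign; [r ^ s] exchanges
    [s x] and [s y], both outside [U], and preserves it. *)
Let sum_conj x y : x \in U :\: V -> y \in U :\: V -> x != y ->
  \sum_(eb | summand eb) stab_sign U (eb.2 * s) = 0.
Proof.
rewrite !inE => /andP [xV xU] /andP [yV yU] xy.
pose r := tperm x y.
have rU : r \in 'N(U | 'P) by apply: tperm_stab; rewrite xU yU.
have rsU : r ^ s \in 'N(U | 'P).
  by rewrite tpermJ; apply: tperm_stab; rewrite (negbTE xV) (negbTE yV).
have conjE b : b ^ r * s = r * (b * s) * r ^ s.
  by rewrite !conjgE {1}/r tpermV -/r !mulgA mulgK.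
apply: (sum_sign_reversing (phi := fun eb => (r eb.1, eb.2 ^ r))).
- case=> e b /andP [/= bcyc bU]; apply/andP; split=> /=.
    by move: bcyc; rewrite !cyclic_onC1 permJ card_porbitsJ inj_eq //; exact: perm_inj.
  by rewrite conjE groupM // groupM.
- by move=> [e b] _ /=; rewrite /r tpermK -conjgM tperm2 conjg1.
move=> [e b] /andP [/= _ bU]; have rbU := groupM rU bU.
rewrite conjE stab_signMr // stab_signM //.
rewrite tpermJ !odd_restr_tperm ?xU ?yU ?(negbTE xV) ?(negbTE yV) //= xy.
by rewrite expr0 expr1 mulr1 mulN1r.
Qed.

(* On [U] the map [b] is a path from [a] to [c] plus, possibly, its fixed point
   [e].  The involution swaps the fixed point inside [U] for one outside: either
   the successor of [a] is cut out and [e] inserted after [c], or the successor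
   of [c] is cut out and [e] inserted after [a]. *)
Let sum_switch (a c : T) : (2 <= #|U|)%N -> (#|U| + 2 <= #|T|)%N ->
  U :\: V = [set a] -> V :\: U = [set c] ->
  \sum_(eb | summand eb) stab_sign U (eb.2 * s) = 0.
Proof.
move=> U2 Un UV VU.
have /setDP [aU aV] : a \in U :\: V by rewrite UV set11.
have /setDP [cV cU] : c \in V :\: U by rewrite VU set11.
have U_a x : x \in U -> x \notin V -> x = a.
  by move=> xU xV; apply/set1P; rewrite -UV inE xV.
have V_c x : x \in V -> x \notin U -> x = c.
  by move=> xV xU; apply/set1P; rewrite -VU inE xU.
have ac : a != c by apply: contraNneq cU => <-.
(* It is applied with [z] in [U] and [y] outside, so that only the first transposition flips the
   sign. The two transpositions have disjoint supports and commute, whence [switch z y] is an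
   involution. *)
pose switch z y b := tperm a z * (tperm c y * b).
have switchC z y b : z \in U -> z != a -> y \notin U -> y != c ->
    switch z y b = tperm c y * (tperm a z * b).
  move=> zU za yU yc; rewrite /switch !mulgA; congr (_ * _).
  apply: (perm_onC (S1 := [set a; z]) (S2 := [set c; y])); rewrite ?tperm_on //.
  apply/pred0P=> x /=; apply/negP=> /andP [xaz xcy].
  have : x \in U by case/set2P: xaz => ->.
  by case/set2P: xcy => ->; apply/negP.
have switchK z y b : z \in U -> z != a -> y \notin U -> y != c ->
    switch z y (switch z y b) = b.
  move=> zU za yU yc; rewrite {1}/switch switchC //.
  by rewrite !tpermKg.
have switch_sign z y b : z \in U -> z != a -> y \notin U -> y != c ->
    b * s \in 'N(U | 'P) -> (switch z y b * s \in 'N(U | 'P)) /\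
    stab_sign U (switch z y b * s) = (- stab_sign U (b * s))%R.
  move=> zU za yU yc bU; rewrite /switch -!mulgA.
  have t1 : tperm a z \in 'N(U | 'P) by apply: tperm_stab; rewrite aU zU.
  have t2 : tperm c y \in 'N(U | 'P).
    by apply: tperm_stab; rewrite (negbTE cU) (negbTE yU).
  have tbU := groupM t2 bU; split; first exact: groupM.
  rewrite (stab_signM t1 tbU) (stab_signM t2 bU) !odd_restr_tperm ?aU ?zU ?(negbTE cU) ?(negbTE yU) //=.
  by rewrite eq_sym za expr0 expr1 mul1r mulN1r.
pose phi (eb : T * {perm T}) : T * {perm T} := let: (e, b) := eb in
  if e \in U then (b c, switch e (b c) b) else (b a, switch (b a) e b).
(* Inserting the old fixed point joins the two cycles into a single one, and cutting out the new one
   splits it again. *)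
have count g x y x' y' : #|porbits g| = 2%N -> x \notin porbit g y -> x' != y' ->
    #|porbits (tperm x' y' * (tperm x y * g))| = 2%N.
  move=> g2 /card_porbits_join; rewrite g2 => -[] g1 xy'.
  by rewrite card_porbits_split ?g1 // (card_porbits1_porbit _ g1) inE.
have phi_in e b : summand (e, b) -> e \in U ->
    [/\ e != a, b c \notin U, b c != c & cyclic_on [set~ b c] (switch e (b c) b)].
  case/andP=> /= bcyc bU eU; have bP := stabE bU.
  have := bcyc; rewrite cyclic_onC1 => /andP [/eqP be /eqP b2].
  have ea : e != a by apply: contraNneq aV => <-; rewrite -be bP.
  have ce : c != e by apply: contraNneq cU => ->.
  have bcU : b c \notin U.
    (* Otherwise [b c = a], and [c |: U] is mapped into itself. It then contains the whole cycle as
       well as [e], contrary to the bound on [#|U|]. *)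
    apply/negP=> bcU; have bca : b c = a by apply: U_a; rewrite ?bP.
    have bW y : y \in c |: U -> b y \in c |: U.
      case/setU1P=> [->|yU]; first by rewrite bca !inE aU orbT.
      have byV : b y \in V by rewrite bP.
      rewrite !inE; have [//|byU] := boolP (b y \in U); first by rewrite orbT.
      by rewrite (V_c _ byV byU) eqxx.
    have cW : c \in c |: U by exact: setU11.
    have eW : e \in c |: U by rewrite !inE eU orbT.
    have sW : [set~ e] \subset (c |: U) :\ e.
      by rewrite subsetD1 !inE eqxx (cyclic_onC1_stable bcyc bW cW ce).
    move: (subset_leq_card sW) (cardsD1 e (c |: U)).
    by rewrite eW cardsC1 cardsU1 cU => {}le1 le2; clear -Un le1 le2; lia.
  have bcc : b c != c.
    apply/negP=> /eqP bcc.
    have bW y : y \in [set c] -> b y \in [set c] by move/set1P=> ->; rewrite bcc set11.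
    have := subset_leq_card (cyclic_onC1_stable bcyc bW (set11 c) ce).
    by rewrite cardsC1 cards1 => le; clear -U2 Un le; lia.
  split=> //; rewrite cyclic_onC1 switchC //; apply/andP; split.
    by rewrite !permM tpermR tpermD // eq_sym.
  rewrite count ?eqxx 1?eq_sym //.
  by rewrite porbit_fix // inE eq_sym.
have phi_out e b : summand (e, b) -> e \notin U ->
    [/\ b a \in U, b a != a, e != c & cyclic_on [set~ b a] (switch (b a) e b)].
  case/andP=> /= bcyc bU eU; have bP := stabE bU.
  have := bcyc; rewrite cyclic_onC1 => /andP [/eqP be /eqP b2].
  have baV : b a \in V by rewrite bP.
  have ec : e != c by apply: contraNneq eU => ec; rewrite -bP be ec.
  have baa : b a != a by apply: contraNneq aV => <-.
  have ae : a != e by apply: contraNneq eU => <-.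
  have baU : b a \in U.
    (* Otherwise [b a = c], and [U :\ a] is mapped into itself. It is nonempty and avoids [e], so it
       contains the whole cycle and is too large. *)
    apply/negPn/negP=> baU; have bac := V_c _ baV baU.
    have bW y : y \in U :\ a -> b y \in U :\ a.
      case/setD1P=> ya yU; have byV : b y \in V by rewrite bP.
      rewrite !inE; apply/andP; split; first by apply: contraNneq aV => <-.
      apply/negPn/negP=> byU; move: ya; rewrite -(inj_eq (@perm_inj _ b)) bac.
      by rewrite (V_c _ byV byU) eqxx.
    have [x xW] : exists x, x \in U :\ a.
      by apply/card_gt0P; move: (cardsD1 a U); rewrite aU => UE; clear -U2 UE; lia.
    have xe : x != e by apply: contraNneq eU => <-; case/setD1P: xW.
    have := subset_leq_card (cyclic_onC1_stable bcyc bW xW xe).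
    move: (cardsD1 a U); rewrite aU cardsC1 => UE le; clear -Un UE le; lia.
  split=> //; rewrite cyclic_onC1; apply/andP; split.
    by rewrite !permM tpermR tpermD // eq_sym.
  rewrite count ?eqxx 1?eq_sym //.
  by rewrite porbit_fix // inE eq_sym.
apply: (sum_sign_reversing (phi := phi)).
- case=> e b eb; rewrite /phi; have /andP [/= _ bU] := eb.
  have [eU|eU] := boolP (e \in U).
    have [ea bcU bcc bcyc] := phi_in _ _ eb eU.
    by rewrite /summand /= bcyc; case: (switch_sign e (b c) b).
  have [baU baa ec bcyc] := phi_out _ _ eb eU.
  by rewrite /summand /= bcyc; case: (switch_sign (b a) e b).
- case=> e b eb; have /andP [/= bcyc bU] := eb.
  move: bcyc; rewrite cyclic_onC1 => /andP [/eqP be _].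
  have [eU|eU] := boolP (e \in U).
    have [ea bcU bcc _] := phi_in _ _ eb eU.
    have -> : phi (b c, switch e (b c) b) = (e, switch e (b c) (switch e (b c) b)).
      rewrite /phi (negbTE bcU).
      suff -> : switch e (b c) b a = e by [].
      rewrite !permM tpermL tpermD //; first by apply: contraNneq cU => ->.
      by apply: contraNneq bcU => ->.
    by rewrite switchK.
  have [baU baa ec _] := phi_out _ _ eb eU.
  have -> : phi (b a, switch (b a) e b) = (e, switch (b a) e (switch (b a) e b)).
    rewrite /phi baU.
    suff -> : switch (b a) e b c = e by [].
    have bac : b a != c by apply: contraNneq cU => <-.
    by rewrite !permM (tpermD ac bac) tpermL be.
  by rewrite switchK.
case=> e b eb; rewrite /phi; have /andP [/= _ bU] := eb.
have [eU|eU] := boolP (e \in U).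
  have [ea bcU bcc bcyc] := phi_in _ _ eb eU.
  by case: (switch_sign e (b c) b).
have [baU baa ec bcyc] := phi_out _ _ eb eU.
by case: (switch_sign (b a) e b).
Qed.

(** Since [#|V| = #|U|], the sets [U :\: V] and [V :\: U] have the same size; sizes 0, 1 and at
    least 2 are [sum_eq], [sum_switch] and [sum_conj]. *)
Lemma sum_stab_sign_cyclic0 : (2 <= #|U|)%N -> (#|U| + 2 <= #|T|)%N ->
  \sum_(eb : T * {perm T} | cyclic_on [set~ eb.1] eb.2 && (eb.2 * s \in 'N(U | 'P)))
     stab_sign U (eb.2 * s) = 0.
Proof.
move=> U2 Un; have cUV := cardsID V U; have cVU := cardsID U V.
rewrite setIC in cVU.
have [UV0|UVn0] := posnP #|U :\: V|.
  apply: sum_eq => //; apply/eqP; rewrite eq_sym eqEcard card_V leqnn andbT.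
  by rewrite -setD_eq0 -cards_eq0 UV0.
have [UV1|UVn1] := eqVneq #|U :\: V| 1%N.
  have /cards1P [a aE] : #|U :\: V| == 1%N by rewrite UV1.
  have /cards1P [c cE] : #|V :\: U| == 1%N by have := card_V; lia.
  exact: sum_switch aE cE.
have /card_gt1P [x [y [xUV yUV xy]]] : (1 < #|U :\: V|)%N by lia.
exact: sum_conj xUV yUV xy.
Qed.

End Cancel.

Lemma cyclic_onC1_neq e g x : (2 < #|T|)%N -> cyclic_on [set~ e] g ->
  x != e -> g x != x.
Proof.
move=> n3 gcyc xe; apply/negP=> /eqP gx.
have bW y : y \in [set x] -> g y \in [set x] by move/set1P=> ->; rewrite gx set11.
have := subset_leq_card (cyclic_onC1_stable gcyc bW (set11 x) xe).
by rewrite cardsC1 cards1; lia.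
Qed.

Lemma sum_cyclic_onC1 : (1 < #|T|)%N ->
  (\sum_(eb : T * {perm T} | cyclic_on [set~ eb.1] eb.2) 1 = #|T| * (#|T| - 2)`!)%N.
Proof.
move=> n2; rewrite -(pair_big_dep xpredT (fun e => cyclic_on [set~ e]) (fun _ _ => 1%N)) /=.
rewrite (eq_bigr (fun=> (#|T| - 2)`!)) ?sum_nat_const // => e _.
rewrite card_cyclic_on ?cardsC1; first by congr (_`!); lia.
by rewrite -card_gt0 cardsC1; lia.
Qed.

(* Conjugation by [tperm u e] turns the fixed point [e] into [u]. *)
Lemma sum_cyclic_onC1_at u v : (2 < #|T|)%N ->
  (\sum_(eb : T * {perm T} | cyclic_on [set~ eb.1] eb.2 && (eb.2 u == v)) 1
   = (#|T| - 2)`!)%N.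
Proof.
move=> n3.
(* A cycle [b] fixing [u] gives the pair whose fixed point [e] is the predecessor of [v] in [b]; the
   conjugate by [tperm u e] fixes [e] and sends [u] to [v]. *)
rewrite (reindex_onto (fun b : {perm T} => (b^-1 v, b ^ tperm u (b^-1 v)))
           (fun eb => eb.2 ^ tperm u eb.1)) /=; last first.
  move=> [e b] /= /andP [bcyc /eqP buv].
  have := bcyc; rewrite cyclic_onC1 => /andP [/eqP be _].
  suff -> : (b ^ tperm u e)^-1 v = e by rewrite -conjgM tperm2 conjg1.
  apply: (@perm_inj _ (b ^ tperm u e)); rewrite permKV.
  rewrite -{2}(tpermL u e) permJ buv; have [ue|ue] := eqVneq u e.
    by rewrite ue tperm1 perm1.
  rewrite tpermD // -buv 1?eq_sym; first exact: cyclic_onC1_neq bcyc ue.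
  by rewrite -[X in _ != X]be inj_eq //; exact: perm_inj.
have <- : (\sum_(b | cyclic_on [set~ u] b) 1 = (#|T| - 2)`!)%N.
  rewrite card_cyclic_on ?cardsC1 ?subn2 //.
  by rewrite -card_gt0 cardsC1; lia.
apply: eq_bigl => b; set e := b^-1 v.
rewrite -conjgM tperm2 conjg1 eqxx andbT.
have E : cyclic_on [set~ e] (b ^ tperm u e) = cyclic_on [set~ u] b.
  rewrite !cyclic_onC1 card_porbitsJ -{2}(tpermL u e) permJ.
  by rewrite -{2}(tpermL u e) inj_eq //; exact: perm_inj.
rewrite E andb_idr // => bcyc; have be : b e = v by rewrite permKV.
have := bcyc; rewrite cyclic_onC1 => /andP [/eqP bu _].
rewrite -{2}(tpermR u e) permJ be; have [ue|ue] := eqVneq u e.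
  by rewrite -ue tperm1 perm1 -be -ue bu.
rewrite tpermD // -be; first by rewrite -{1}bu inj_eq //; exact: perm_inj.
by rewrite eq_sym; apply: cyclic_onC1_neq bcyc _ => //; rewrite eq_sym.
Qed.

Lemma stab_set1 x g : (g \in 'N([set x] | 'P)) = (g x == x).
Proof.
apply/perm_stabP/eqP => [/(_ x)|gx y]; first by rewrite !inE eqxx => /eqP.
by rewrite !inE -{1}gx inj_eq //; exact: perm_inj.
Qed.

Lemma stab_setC1 x g : (g \in 'N([set~ x] | 'P)) = (g x == x).
Proof.
rewrite -stab_set1; apply/perm_stabP/perm_stabP => gx y;
  by move: (gx y); rewrite !inE => /(congr1 negb); rewrite ?negbK.
Qed.

Lemma porbits_in0 g : porbits_in set0 g = set0.
Proof.
apply/setP=> C; rewrite !inE; case: imsetP => // -[y _ ->] /=.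
by rewrite porbit_subset ?inE // => z; rewrite !inE.
Qed.

Lemma stab_sign1 x g : g x = x -> stab_sign [set x] g = (-1)%R.
Proof.
move=> gx; have g0 : g \in 'N(set0 | 'P) by apply/perm_stabP=> y; rewrite !inE.
have x0 : x \notin set0 by rewrite inE.
have := card_porbits_in_toggle g0 x0; rewrite set0U porbit_fix // porbits_in0 cards0.
by rewrite /stab_sign => ->; rewrite expr1.
Qed.

Lemma stab_signC1 x g : g x = x ->
  stab_sign [set~ x] g = ((-1) ^+ (~~ odd #|porbits g|))%R.
Proof.
move=> gx; have gU : g \in 'N([set~ x] | 'P) by rewrite stab_setC1 gx.
have xU : x \notin [set~ x] by rewrite !inE eqxx.
have := card_porbits_in_toggle gU xU; rewrite porbit_fix // setUC setUCr.
have -> : porbits_in setT g = porbits g.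
  by apply/setP=> C; rewrite !inE subsetT andbT.
by rewrite /stab_sign => ->; rewrite /= negbK signr_odd.
Qed.

(** In units of [m], the empty set contributes [n], each of the [n - 1] singletons avoiding [p]
    contributes -1, and the complement of [p] contributes 1. The total is 2, all other sets giving
    0. *)
Lemma card_boccara s : odd_perm s -> (2 < #|T|)%N ->
  (\sum_e \sum_(b | cyclic_on [set~ e] b) (#|porbits (b * s)%g| == 1) = 2 * (#|T| - 2)`!)%N.
Proof.
move=> s_odd n3; set n := #|T|; pose m := ((n - 2)`!)%N.
have [p _] : exists p : T, p \in T by apply/card_gt0P; rewrite -/n; lia.
rewrite (pair_big_dep xpredT (fun e => cyclic_on [set~ e])
          (fun _ b => nat_of_bool (#|porbits (b * s)%g| == 1%N))) /=.
apply/eqP; rewrite -(Num.Theory.eqr_nat int) natr_sum.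
under eq_bigr => eb _ do rewrite -(sum_stab_sign p).
rewrite (exchange_big_dep (fun U : {set T} => p \notin U)) /=; last first.
  by move=> eb U _ /andP [].
pose W (U : {set T}) := \sum_(eb : T * {perm T} | cyclic_on [set~ eb.1] eb.2 &&
   (eb.2 * s \in 'N(U | 'P))) stab_sign U (eb.2 * s).
rewrite (eq_bigr W) => [|U pU]; last by apply: eq_bigl => eb; rewrite pU.
have W0 : W set0 = (n * m)%:R.
  rewrite -(sum_cyclic_onC1 (ltnW n3)) natr_sum; apply: eq_big => [eb|eb _].
    by rewrite (_ : _ \in _) ?andbT //; apply/perm_stabP=> x; rewrite !inE.
  by rewrite /stab_sign porbits_in0 cards0.
have bs_fix u b : ((b * s) u == u) = (b u == s^-1 u).
  by rewrite permM -(inj_eq (@perm_inj _ s) (b u)) permKV.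
have W1 u : W [set u] = (- m%:R)%R.
  rewrite /m -(sum_cyclic_onC1_at u (s^-1 u) n3) natr_sum -sumrN.
  apply: eq_big => [eb|eb /andP [_]]; first by rewrite stab_set1 bs_fix.
  by rewrite stab_set1 => /eqP; exact: stab_sign1.
have WC : W [set~ p] = m%:R.
  rewrite /m -(sum_cyclic_onC1_at p (s^-1 p) n3) natr_sum.
  apply: eq_big => [eb|[e b] /= /andP []]; first by rewrite stab_setC1 bs_fix.
  rewrite cyclic_onC1 stab_setC1 => /andP [_ /eqP b2] /eqP bs.
  rewrite stab_signC1 //.
  (* The oddness of [s] enters here: as [b] has two cycles, [b * s] has an odd number of them, so
     the complement of its fixed point [p] contains an even number and has sign 1. *)
  have : odd_perm (b * s) = odd_perm b (+) true by rewrite odd_permM s_odd.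
  rewrite {1 2}/odd_perm b2 /= addbF.
  by case: (odd #|T|); case: (odd _).
have subC U : (p \notin U) = (U \subset [set~ p]).
  by rewrite subsetC sub1set inE.
rewrite (bigD1 set0) ?inE //= W0 (bigD1 [set~ p]); last first.
  rewrite !inE eqxx /= -card_gt0 cardsC1; lia.
rewrite /= WC (bigID (fun U : {set T} => #|U| == 1%N)) /= [X in _ + (_ + (_ + X))]big1; last first.
  move=> U /andP [/andP [/andP [pU U0] UC] U1].
  apply: sum_stab_sign_cyclic0.
    by move: U0 U1; rewrite -card_gt0; case: #|U| => // -[].
  move: UC; rewrite eqEcard -subC pU cardsC1 /= -/n; lia.
rewrite (eq_bigl (fun U => U \in [set U : {set T} | (U \subset [set~ p]) & (#|U| == 1%N)])); last first.
  move=> U; rewrite inE -subC; case: (#|U| =P 1%N) => [U1|_]; rewrite ?andbF // !andbT.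
  case: (p \notin U) => //=; rewrite -card_gt0 U1 /=.
  apply: contra_eq_neq U1 => ->; rewrite cardsC1 -/n; lia.
rewrite (eq_bigr (fun=> (- m%:R)%R)) => [|U]; last first.
  by rewrite inE => /andP [_ /cards1P [u ->]]; exact: W1.
rewrite sumr_const cards_draws cardsC1 -/n -/m bin1.
apply/eqP; rewrite addr0 -mulNrn natrM.
have -> : n = n.-1.+1 by lia.
by rewrite /= -mulr_natr -[(n.-1.+1)%:R]natr1; ring.
Qed.

End Boccara.

(** * Pairs of full cycles on the same [k] points *)

Lemma cyclic_onV (T : finType) (A : {set T}) (g : {perm T}) :
  cyclic_on A g^-1 = cyclic_on A g.
Proof.
rewrite /cyclic_on porbitsV; congr (_ && _).
by apply/idP/idP => /perm_onV; rewrite ?invgK.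
Qed.

Section Zagier.
Local Open Scope nat_scope.

(** Double counting of the pairs of a full cycle on [k.+1] points and a [k]-cycle missing a point
    [e], with a product having [r] cycles. Deleting [e] from the full cycle gives the left side.
    Fixing the product gives the right side by [card_boccara], the parity condition making it
    odd. *)
Lemma card_zagier_gt1 k r : 1 < k -> ~~ odd (k + r) ->
  cyclic_pairs [set: 'I_k] [set: 'I_k] r * (k * k.+1)
  = 2 * (k.-1)`! * #|[set s : 'S_k.+1 | #|porbits s| == r]|.
Proof.
move=> k1 kr.
have E (e : 'I_k.+1) : cyclic_pairs [set: 'I_k.+1] [set~ e] r
    = k * cyclic_pairs [set: 'I_k] [set: 'I_k] r.
  rewrite (@cyclic_pairsD1 _ _ _ e) ?inE ?eqxx //; last first.
    by apply/eqP=> /(congr1 (fun A : {set _} => #|A|)); rewrite cardsT card_ord cards1; lia.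
  rewrite cardsT card_ord; congr (_ * _).
  have -> : [set: 'I_k.+1] :\ e = [set~ e] by apply/setP=> x; rewrite !inE andbT.
  have -> : [set~ e] = lift e @: [set: 'I_k].
    apply/setP=> x; rewrite !inE; apply/idP/imsetP => [xe|[y _ ->]].
      by case: (unliftP e x) xe => [y ->|->]; [exists y | rewrite eqxx].
    by rewrite eq_sym neq_lift.
  by apply: cyclic_pairs_transfer; rewrite ?card_ord ?addnS //; exact: lift_inj.
transitivity (\sum_(e : 'I_k.+1) cyclic_pairs [set: 'I_k.+1] [set~ e] r).
  by rewrite (eq_bigr _ (fun e _ => E e)) sum_nat_const card_ord; ring.
transitivity (\sum_(s : 'S_k.+1 | #|porbits s| == r) \sum_(e : 'I_k.+1)
    \sum_(b | cyclic_on [set~ e] b) (#|porbits (b * s)%g| == 1)); last first.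
  rewrite (eq_bigr (fun=> 2 * (k.-1)`!)) => [|s /eqP sr]; last first.
    rewrite card_boccara ?card_ord ?subSS ?subn1 //.
    move: kr; rewrite /odd_perm card_ord sr oddD /=.
    by case: (odd k); case: (odd r).
  by rewrite sum_nat_const mulnC; congr (_ * _); apply: eq_card => s; rewrite inE.
rewrite [RHS]exchange_big /=; apply: eq_bigr => e _.
rewrite [RHS]exchange_big /= /cyclic_pairs [LHS]exchange_big /=.
(* With [b] inverted and [a] written as [b * s], the product [a * b] becomes a conjugate of [s]. *)
rewrite [LHS](reindex_inj invg_inj) /=.
apply: eq_big => [b|b _]; first exact: cyclic_onV.
rewrite [LHS](reindex_inj (mulgI b)) /= big_mkcond [RHS]big_mkcond.
apply: eq_bigr => s _; rewrite card_porbitsC mulKg.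
have -> : cyclic_on [set: 'I_k.+1] (b * s)%g = (#|porbits (b * s)%g| == 1).
  rewrite /cyclic_on cardsT card_ord -[k.+2]add1n eqn_add2r.
  by rewrite (_ : perm_on _ _) //; apply/subsetP=> x; rewrite inE.
by case: (_ == 1); case: (_ == r).
Qed.

(** [card_boccara] requires three points, so [k = 1] is treated by hand; both sides are then 2 if
    [r = 1] and 0 otherwise. *)
Lemma card_zagier k r : 0 < k -> ~~ odd (k + r) ->
  cyclic_pairs [set: 'I_k] [set: 'I_k] r * (k * k.+1)
  = 2 * (k.-1)`! * #|[set s : 'S_k.+1 | #|porbits s| == r]|.
Proof.
case: k => // -[|k] _ kr; last exact: card_zagier_gt1.
have T1 : [set: 'I_1] = [set ord0] by apply/setP=> x; rewrite !inE ord1.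
have -> : cyclic_pairs [set: 'I_1] [set: 'I_1] r = (1 == r).
  rewrite /cyclic_pairs T1 (eq_bigl _ _ (cyclic_on1 _)) big_pred1_eq.
  rewrite (eq_bigl _ _ (cyclic_on1 _)) big_pred1_eq mulg1.
  have : cyclic_on [set (ord0 : 'I_1)] 1 by rewrite cyclic_on1.
  by case/andP=> _; rewrite cards1 card_ord addn1 => /eqP [->].
have -> : #|[set s : 'S_2 | #|porbits s| == r]| = (1 == r).
  have [r1|r1] := eqVneq 1 r.
    have T0 : [set: 'I_2] != set0 by apply/set0Pn; exists ord0; rewrite inE.
    have T2 := card_cyclic_on T0; rewrite cardsT card_ord in T2.
    rewrite -[RHS]T2 -sum1_card; apply: eq_bigl => s; rewrite inE -r1.
    rewrite /cyclic_on cardsT card_ord -[3]/(1 + 2) eqn_add2r.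
    by rewrite (_ : perm_on _ _) //; apply/subsetP=> x; rewrite inE.
  apply: eq_card0 => s; rewrite inE; apply/negP=> /eqP sr.
  have : #|porbits s| <= 2 by rewrite -[X in _ <= X]card_ord; exact: leq_imset_card.
  have : 0 < #|porbits s| by apply/card_gt0P; exists (porbit s ord0); exact: imset_f.
  by rewrite sr; move: r1 kr; case: r {sr} => [|[|[|]]].
by case: (1 == r).
Qed.

End Zagier.

(** * Pairs of cycles on two given supports, and the choice of the supports *)

Section Supports.
Local Open Scope nat_scope.
Variable T : finType.
Implicit Types (A B K : {set T}).

(** The points outside [K] are fixed, which leaves [c + #|K| - #|T|] cycles on [K]. If this is
    negative, both sides vanish. *)
Lemma card_zagier_on K c : K != set0 -> ~~ odd (c + #|T|) ->
  cyclic_pairs K K c * (#|K| * #|K|.+1)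
  = 2 * (#|K|.-1)`! * #|[set s : 'S_#|K|.+1 | #|porbits s| + #|T| == c + #|K|]|.
Proof.
move=> K0 cT; have k0 : 0 < #|K| by rewrite card_gt0.
have KE : enum_val @: [set: 'I_#|K|] = K.
  apply/setP=> x; apply/imsetP/idP => [[y _ ->]|xK]; first exact: enum_valP.
  by exists (enum_rank_in xK x); rewrite ?enum_rankK_in.
have [le|lt] := leqP #|T| (c + #|K|); last first.
  have -> : cyclic_pairs K K c = 0.
    apply: big1 => a /andP [aK _]; apply: big1 => b /andP [bK _].
    have /card_gt0P [x xK] := k0.
    have := card_porbits_on_ge (perm_onM aK bK) xK.
    by case: eqP => // ->; rewrite ltnNge ltnW.
  rewrite (_ : [set _ | _] = set0) ?cards0 ?muln0 //.
  by apply/setP=> s; rewrite !inE; apply/eqP=> sE; move: lt; rewrite -sE ltnNge leq_addl.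
have cE : c + #|'I_#|K| | = (c + #|K| - #|T|) + #|T| by rewrite card_ord subnK.
have := cyclic_pairs_transfer (f := enum_val (A := mem K)) enum_val_inj cE.
rewrite KE => ->; rewrite card_zagier //.
  congr (_ * _); apply: eq_card => s; rewrite !inE.
  by rewrite -(eqn_add2r #|T|) subnK.
move: cT; rewrite !oddD oddB // oddD.
by case: (odd c); case: (odd #|K|); case: (odd #|T|).
Qed.

(** Two reductions shrink first [A], then [B], to the intersection [K], where [card_zagier_on]
    applies. Each reduction brings in a factorial of [#|K|.-1], hence the cancellation at the
    end. *)
Lemma cyclic_pairs_meet A B c : A :&: B != set0 -> ~~ odd (c + #|A| + #|B| + #|T|) ->
  cyclic_pairs A B c * (#|A :&: B|.+1)`!
  = 2 * (#|A|.-1)`! * (#|B|.-1)`! *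
    #|[set s : 'S_#|A :&: B|.+1 | #|porbits s| + #|T| + #|A :&: B| == c + #|A| + #|B|]|.
Proof.
move=> AB0 par; set K := A :&: B; have k0 : 0 < #|K| by rewrite card_gt0.
have leA : #|K| <= #|A| by apply/subset_leq_card/subsetIl.
have leB : #|K| <= #|B| by apply/subset_leq_card/subsetIr.
have E1 : cyclic_pairs A B c * (#|K|.-1)`! =
    (#|A|.-1)`! * cyclic_pairs B K (c + (#|A| - #|K|)).
  rewrite (cyclic_pairsC B); apply: cyclic_pairs_reduce => //; first exact: subsetIl.
  rewrite -setI_eq0; apply/eqP/setP=> x; rewrite !inE.
  by case: (x \in A); case: (x \in B).
have E2 : cyclic_pairs B K (c + (#|A| - #|K|)) * (#|K|.-1)`! =
    (#|B|.-1)`! * cyclic_pairs K K (c + (#|A| - #|K|) + (#|B| - #|K|)).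
  apply: cyclic_pairs_reduce => //; first exact: subsetIr.
  rewrite -setI_eq0; apply/eqP/setP=> x; rewrite !inE.
  by case: (x \in A); case: (x \in B).
have par' : ~~ odd (c + (#|A| - #|K|) + (#|B| - #|K|) + #|T|).
  move: par; rewrite !oddD !oddB //.
  by case: (odd c); case: (odd #|A|); case: (odd #|B|); case: (odd #|K|).
have E3 := card_zagier_on AB0 par'; rewrite -/K in E3.
have SE : [set s : 'S_#|K|.+1 | #|porbits s| + #|T| ==
             c + (#|A| - #|K|) + (#|B| - #|K|) + #|K|]
   = [set s : 'S_#|K|.+1 | #|porbits s| + #|T| + #|K| == c + #|A| + #|B|].
  apply/setP=> s; rewrite !inE -(eqn_add2r #|K|); congr (_ == _).
  by clear -leA leB; lia.
rewrite SE in E3.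
have kf : (#|K|.+1)`! = #|K| * #|K|.+1 * (#|K|.-1)`!.
  by rewrite factS -{2}(prednK k0) factS prednK //; ring.
have kf0 : 0 < (#|K|.-1)`! := fact_gt0 _.
apply/eqP; rewrite -(eqn_pmul2r kf0) kf; apply/eqP.
set N := cyclic_pairs A B c in E1 *; set S := #|_| in E3 *.
set P := cyclic_pairs B K _ in E1 E2; set Q := cyclic_pairs K K _ in E2 E3.
transitivity (#|K| * #|K|.+1 * ((#|A|.-1)`! * P * (#|K|.-1)`!)).
  by rewrite -E1; ring.
rewrite -(mulnA _ P) E2.
transitivity ((#|A|.-1)`! * (#|B|.-1)`! * (Q * (#|K| * #|K|.+1))); first by ring.
by rewrite E3; ring.
Qed.

(** Here [A] shrinks to a single point, whose only full cycle is the identity, so the product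
    becomes [b] and its cycle count is known. *)
Lemma cyclic_pairs_disjoint A B c : A != set0 -> B != set0 -> A :&: B = set0 ->
  cyclic_pairs A B c = (#|A|.-1)`! * (#|B|.-1)`! * (c + #|A| + #|B| == #|T| + 2).
Proof.
move=> /set0Pn [x xA] B0 AB.
have x0 : [set x] != set0 by apply/set0Pn; exists x; rewrite set11.
have a0 : 0 < #|A| by rewrite (cardsD1 x) xA.
have := @cyclic_pairs_reduce _ [set x] A B c x0; rewrite sub1set xA cards1 muln1.
move=> -> //; last first.
  rewrite -setI_eq0; apply/eqP/setP=> y; move/setP/(_ y): AB; rewrite !inE.
  by case: (y \in A); case: (y \in B) => //=; rewrite ?andbF.
rewrite -mulnA; congr (_ * _).
rewrite {1}/cyclic_pairs (eq_bigl _ _ (cyclic_on1 x)) big_pred1_eq.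
rewrite -(card_cyclic_on B0) big_distrl /=; apply: eq_bigr => b /andP [_ /eqP bn].
rewrite mul1g mul1n; congr (nat_of_bool _).
by move: bn a0; clear; move: #|porbits b| #|A| #|B| #|T| => u v w y; lia.
Qed.

(** The set [B] splits into its part in [A] and its part outside. The latter omits [s] points of the
    complement of [A], which forces the former to have [k] points. *)
Lemma card_sets_meet A q s k : k + #|T| = #|A| + q + s -> s <= #|~: A| ->
  #|[set B : {set T} | (#|B| == q) && (#|~: (A :|: B)| == s)]|
  = 'C(#|A|, k) * 'C(#|~: A|, s).
Proof.
move=> kE sA; pose d := #|~: A| - s.
pose P := [set X : {set T} | X \subset A & #|X| == k].
pose Q := [set Y : {set T} | Y \subset ~: A & #|Y| == d].
have AC := cardsC A.
have meetE (X Y : {set T}) : X \subset A -> Y \subset ~: A ->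
    (X :|: Y) :&: A = X /\ (X :|: Y) :&: ~: A = Y.
  move=> XA YA; split; apply/setP=> x; rewrite !inE.
    move: (subsetP XA x) (subsetP YA x); rewrite inE.
    by case: (x \in X); case: (x \in Y); case: (x \in A) => //= H1 H2; first [exact: H1 | exact: H2 | move: (H1 isT) | move: (H2 isT)].
  move: (subsetP XA x) (subsetP YA x); rewrite inE.
  by case: (x \in X); case: (x \in Y); case: (x \in A) => //= H1 H2; first [exact: H1 | exact: H2 | move: (H1 isT) | move: (H2 isT)].
have joinE (B : {set T}) : #|B| = #|B :&: A| + #|B :&: ~: A| by rewrite -(cardsID A B) setDE.
have outE (B : {set T}) : #|~: A| = #|B :&: ~: A| + #|~: (A :|: B)|.
  by rewrite -(cardsID B (~: A)) setDE -setCU [B :&: _]setIC.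
have -> : [set B : {set T} | (#|B| == q) && (#|~: (A :|: B)| == s)]
    = (fun XY => XY.1 :|: XY.2) @: setX P Q.
  apply/setP=> B; rewrite inE; apply/andP/imsetP.
    case=> /eqP Bq /eqP ABs; exists (B :&: A, B :&: ~: A); last first.
      by rewrite /= -setDE setID.
    rewrite !inE !subsetIr /=.
    move: (joinE B) (outE B); rewrite ABs Bq /d => jE oE.
    by apply/andP; split; apply/eqP; clear -jE oE AC kE sA; lia.
  case=> -[X Y]; rewrite !inE => /andP [/andP [XA /eqP Xk] /andP [YA /eqP Yd]] -> /=.
  have [XE YE] := meetE X Y XA YA.
  move: (joinE (X :|: Y)) (outE (X :|: Y)); rewrite XE YE Xk Yd /d => jE oE.
  by split; apply/eqP; clear -jE oE AC kE sA; lia.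
rewrite card_in_imset => [|[X Y] [X' Y']]; last first.
  rewrite !inE /= => /andP [/andP [XA _] /andP [YA _]].
  case/andP=> /andP [XA' _] /andP [YA' _] E.
  have [XE YE] := meetE X Y XA YA; have [XE' YE'] := meetE X' Y' XA' YA'.
  by congr (_, _); [rewrite -XE E | rewrite -YE E].
by rewrite cardsX !cards_draws /d bin_sub.
Qed.

Lemma card_sets_meet0 A q s : #|A| + q + s < #|T| ->
  [set B : {set T} | (#|B| == q) && (#|~: (A :|: B)| == s)] = set0.
Proof.
move=> lt; apply/setP=> B; rewrite !inE; apply/andP=> -[/eqP Bq /eqP ABs].
move: (cardsC (A :|: B)) (cardsUI A B); rewrite Bq ABs => E1 E2.
by clear -lt E1 E2; lia.
Qed.

End Supports.

(** * From cycle types to supports *)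

Lemma perm_enum_setD1 (I : finType) (P : {set I}) x : x \in P ->
  perm_eq (enum P) (x :: enum (P :\ x)).
Proof.
move=> xP; apply: uniq_perm; first exact: enum_uniq.
  by rewrite /= mem_enum setD11 enum_uniq.
by move=> y; rewrite inE !mem_enum in_setD1; case: eqP => [->|].
Qed.

Section Triples.
Local Open Scope nat_scope.
Variable n : nat.

Lemma perm_eq_cycle_type (a : 'S_n) (la : seq nat) : sorted geq la ->
  (cycle_type a == la) = perm_eq [seq #|(C : {set _})| | C <- enum (porbits a)] la.
Proof.
move=> la_sorted; have geqT : total geq by move=> x y; exact: leq_total.
have geq_tr : transitive geq by move=> x y z xy yz; exact: leq_trans yz xy.
have geq_anti : antisymmetric geq by move=> x y; rewrite andbC; exact: anti_leq.
apply/eqP/idP => [<-|lap]; first by rewrite perm_sym perm_sort.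
by apply: (sorted_eq geq_tr geq_anti); rewrite ?sort_sorted // perm_sort.
Qed.

Lemma sorted_hook p k : 0 < p -> sorted geq (p :: nseq k 1).
Proof. by elim: k p => //= k IH p p0; rewrite p0; exact: IH. Qed.

Lemma cyclic_on_cycle_type (a : 'S_n) (A : {set 'I_n}) : A != set0 -> cyclic_on A a ->
  cycle_type a = #|A| :: nseq (n - #|A|) 1.
Proof.
move=> A0 acyc; have a0 : 0 < #|A| by rewrite card_gt0.
have [aA /eqP an] := andP acyc.
have [x xA] := set0Pn _ A0.
have AP : A \in porbits a by rewrite -(cyclic_on_porbit acyc xA) imset_f.
apply/eqP; rewrite perm_eq_cycle_type ?sorted_hook //.
have PE := perm_enum_setD1 AP.
apply: perm_trans (perm_map _ PE) _; rewrite /= perm_cons.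
have -> : [seq #|(C : {set _})| | C <- enum (porbits a :\ A)]
    = nseq (size (enum (porbits a :\ A))) 1.
  rewrite -[in RHS](size_map (fun C : {set _} => #|C|)); apply/all_pred1P/allP=> l /mapP [C].
  rewrite mem_enum => /setD1P [CA /imsetP [y _ CE]] ->.
  have yA : y \notin A.
    by apply: contra CA => yA; rewrite CE (cyclic_on_porbit acyc yA).
  by rewrite /= CE porbit_fix ?cards1 // (out_perm aA).
rewrite -cardE; have := cardsD1 A (porbits a); rewrite AP => pE.
rewrite (_ : #|porbits a :\ A| = n - #|A|) //.
by move: an; rewrite card_ord pE; clear; move: #|_ :\ A| #|A| => u v; lia.
Qed.

Lemma cycle_type_cyclic_on (a : 'S_n) p : p <= n ->
  cycle_type a = p :: nseq (n - p) 1 -> 0 < p -> exists2 A : {set 'I_n}, #|A| = p & cyclic_on A a.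
Proof.
move=> pn /eqP ct p0; move: ct; rewrite perm_eq_cycle_type ?sorted_hook // => pe.
have : p \in [seq #|(C : {set _})| | C <- enum (porbits a)].
  by rewrite (perm_mem pe) mem_head.
case/mapP=> A; rewrite mem_enum => AP pA; exists A => //.
have PE := perm_enum_setD1 AP.
have sz := perm_size pe; rewrite size_map -cardE /= size_nseq in sz.
apply/andP; split; last by rewrite sz -pA card_ord addSn subnK.
move: pe; rewrite (permPl (perm_map _ PE)) /= -pA perm_cons => pe.
apply/subsetP=> y; rewrite inE; apply: contraR => yA; apply/eqP.
have : #|porbit a y| \in nseq (n - p) 1.
  rewrite -(perm_mem pe); apply: map_f; rewrite mem_enum !inE imset_f // andbT.
  by apply: contraNneq yA => <-; exact: porbit_id.
rewrite mem_nseq => /andP [_ /cards1P [z zE]].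
have := porbit_id a y; rewrite zE => /set1P yz.
by have := mem_porbit a 1 y; rewrite zE -yz => /set1P; rewrite expg1.
Qed.

Lemma cyclic_on_support (a : 'S_n) (A B : {set 'I_n}) : 1 < #|A| -> 1 < #|B| ->
  cyclic_on A a -> cyclic_on B a -> A = B.
Proof.
suff sub (C D : {set 'I_n}) : 1 < #|C| -> cyclic_on C a -> cyclic_on D a -> C \subset D.
  by move=> A1 B1 aA aB; apply/eqP; rewrite eqEsubset !sub.
move=> C1 aC /andP [aD _]; apply/subsetP=> x xC.
apply: contraLR C1 => xD; rewrite -(cyclic_on_porbit aC xC) porbit_fix ?cards1 //.
exact: out_perm aD xD.
Qed.

(** For [p > 1] the support of a [p]-cycle is unique, so at most one term is nonzero; for [p = 1]
    the identity would be counted once for each point. *)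
Lemma sum_cyclic_on_support (a : 'S_n) p : 1 < p -> p <= n ->
  \sum_(A : {set 'I_n} | #|A| == p) cyclic_on A a = (cycle_type a == p :: nseq (n - p) 1).
Proof.
move=> p1 pn; case: eqP => [ct|ct].
  have [A pA aA] := cycle_type_cyclic_on pn ct (ltnW p1).
  rewrite (bigD1 A) ?pA //= aA big1 // => B /andP [/eqP pB BA].
  apply/eqP; rewrite eqb0; apply: contra BA => aB.
  by rewrite (cyclic_on_support _ _ aB aA) ?pA ?pB.
apply: big1 => A /eqP pA; apply/eqP; rewrite eqb0; apply/negP=> aA; apply: ct.
by rewrite -pA; apply: cyclic_on_cycle_type aA; rewrite -card_gt0 pA ltnW.
Qed.

(** The first permutation of a triple is the inverse of [a * b] and has as many cycles as [a * b].
    The pairs are then sorted by the supports of [a] and [b]. *)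
Lemma num_triples_pairs m p q : 1 < p -> p <= n -> 1 < q -> q <= n ->
  num_triples n m (p :: nseq (n - p) 1) (q :: nseq (n - q) 1)
  = \sum_(A : {set 'I_n} | #|A| == p) \sum_(B : {set 'I_n} | #|B| == q) cyclic_pairs A B m.
Proof.
move=> p1 pn q1 qn; rewrite /num_triples.
set la := p :: _; set mu := q :: _.
transitivity (\sum_(a : 'S_n) \sum_(b : 'S_n)
    (cycle_type a == la) * (cycle_type b == mu) * (#|porbits (a * b)%g| == m)).
  pose f (ab : 'S_n * 'S_n) := ((ab.1 * ab.2)^-1%g, ab.1, ab.2).
  have f_inj : injective f by case=> a b [a' b'] [_ -> ->].
  rewrite (_ : [set x | _] = f @: [set ab : 'S_n * 'S_n |
    [&& cycle_type ab.1 == la, cycle_type ab.2 == mu & #|porbits (ab.1 * ab.2)%g| == m]]).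
    rewrite card_imset // -sum1_card pair_bigA /= big_mkcond /=; apply: eq_bigr => -[a b] _.
    rewrite inE /=.
    by case: (_ == la); case: (_ == mu); case: (_ == m).
  apply/setP=> -[[s a] b]; rewrite inE; apply/and4P/imsetP.
    case=> /eqP sab ca cb cs; have sE : s = (a * b)^-1%g.
      by apply/eqP; rewrite eq_mulgV1 invgK mulgA sab.
    exists (a, b); last by rewrite /f /= sE.
    by rewrite inE /= ca cb; move: cs; rewrite /num_cycles sE porbitsV.
  case=> -[a' b'] /[!inE] /= /and3P [ca cb cs] [-> -> ->].
  by rewrite -mulgA mulVg eqxx ca cb /num_cycles porbitsV.
transitivity (\sum_(a : 'S_n) \sum_(b : 'S_n)
  \sum_(A : {set 'I_n} | #|A| == p) \sum_(B : {set 'I_n} | #|B| == q)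
    cyclic_on A a * cyclic_on B b * (#|porbits (a * b)%g| == m)).
  apply: eq_bigr => a _; apply: eq_bigr => b _.
  rewrite -(sum_cyclic_on_support a p1 pn) -(sum_cyclic_on_support b q1 qn).
  rewrite big_distrlr /= big_distrl /=; apply: eq_bigr => A _.
  by rewrite big_distrl.
under eq_bigr => a _ do rewrite exchange_big /=.
rewrite exchange_big /=; apply: eq_bigr => A _.
under eq_bigr => a _ do rewrite exchange_big /=.
rewrite exchange_big /=; apply: eq_bigr => B _.
rewrite /cyclic_pairs [RHS]big_mkcond; apply: eq_bigr => a _.
case: (cyclic_on A a); last by rewrite big1.
rewrite [RHS]big_mkcond; apply: eq_bigr => b _.
by case: (cyclic_on B b); rewrite ?mul1n.
Qed.

End Triples.

(** * Evaluation of the sum over supports *)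

Lemma sum_fiber_nat (I : finType) (P : pred I) (f : I -> nat) M (F : I -> nat) :
  (forall i, P i -> (f i < M)%N) ->
  (\sum_(i | P i) F i = \sum_(0 <= s < M) \sum_(i | P i && (f i == s)) F i)%N.
Proof.
move=> fM; rewrite big_mkord.
rewrite (exchange_big_dep P) /=; last by move=> s i _ /andP [].
apply: eq_bigr => i Pi; rewrite (bigD1 (Ordinal (fM i Pi))) /= ?Pi ?eqxx //.
rewrite big1 ?addn0 // => s /andP [/eqP fs]; case/eqP; exact: val_inj.
Qed.

Lemma natr_bin (a b : nat) :
  ('C(a + b, a)%:R : rat) = (a + b)`!%:R / (a`!%:R * b`!%:R).
Proof.
have f0 l : (l`!%:R : rat) != 0 by rewrite Num.Theory.pnatr_eq0 -lt0n fact_gt0.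
apply: (canRL (mulfK _)); first by rewrite mulf_neq0.
by rewrite -!natrM -{2}[b](addKn a) bin_fact ?leq_addr.
Qed.

(* The common values [i = k + x], [j = x + s + t], for cycles of lengths
   [k + x + t] and [k + x] whose supports share [k] points and miss [s]. *)
Lemma meet_term (k s x t S : nat) : (0 < k)%N ->
  'C(k + x + (x + s + t), k + x + t)%:R * (('C(k + x + t, k) * 'C(x + s, s))%N%:R *
    (2 * ((k + x + t).-1)`!%:R * ((k + x).-1)`!%:R * S%:R / (k.+1)`!%:R))
  = ((k + x + (x + s + t))`!)%N%:R / (s`! * k)%N%:R
    * 'C(k + x - 1, x)%N%:R * 'C(k + x + t - 1, x + t)%N%:R
    * (S%:R / 'C(k + 1, 2)%N%:R) :> rat.
Proof.
case: k => // k _.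
have nat0 l : (0 < l)%N -> (l%:R : rat) != 0.
  by move=> l0; rewrite Num.Theory.pnatr_eq0 -lt0n.
have fact0 l : (l`!%:R : rat) != 0 by apply: nat0; exact: fact_gt0.
have BE : 'C(k.+1 + x + (x + s + t), k.+1 + x + t)%:R
    = (k.+1 + x + (x + s + t))`!%:R / ((k.+1 + x + t)`!%:R * (x + s)`!%:R) :> rat.
  rewrite (_ : k.+1 + x + (x + s + t) = k.+1 + x + t + (x + s))%N; last by ring.
  exact: natr_bin.
rewrite {}BE; move: (k.+1 + x + (x + s + t))`!%:R => F.
rewrite ['C(k.+1 + x + t, k.+1)](_ : _ = 'C(k.+1 + (x + t), k.+1)); last by rewrite addnA.
rewrite [('C(_, _) * _)%:R]natrM [in 'C(x + s, s)]addnC.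
rewrite [(s`! * _)%:R]natrM.
rewrite !natr_bin.
have -> : (k.+1 + x - 1 = x + k)%N by lia.
have -> : (k.+1 + x + t - 1 = x + t + k)%N by lia.
rewrite !natr_bin.
have -> : ((k.+1 + x + t).-1 = x + t + k)%N by lia.
have -> : ((k.+1 + x).-1 = x + k)%N by lia.
have -> : (k.+1 + 1 = 2 + k)%N by lia.
rewrite natr_bin.
have f2 : ((k.+2)`!%:R : rat) = k.+2%:R * (k.+1%:R * k`!%:R) by rewrite -!natrM.
have f1 : ((k.+1)`!%:R : rat) = k.+1%:R * k`!%:R by rewrite -!natrM.
rewrite (_ : (2 + k)`! = (k.+2)`!) // f2 (_ : (k.+1 + (x + t) = k.+1 + x + t)%N) ?addnA //.
rewrite f1 (_ : (2`!)%:R = 2 :> rat) // [(s + x)%N]addnC.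
have k1 : (k.+1%:R : rat) != 0 by exact: nat0.
have k2 : (k.+2%:R : rat) != 0 by exact: nat0.
(* The remaining factorials are generalized to independent nonzero variables, which leaves an
   identity of rational functions. *)
move: (fact0 k) (fact0 x) (fact0 s) (fact0 (x + t)%N) (fact0 (x + s)%N) (fact0 (k.+1 + x + t)%N) k1 k2.
move: k.+1%:R k.+2%:R k`!%:R x`!%:R s`!%:R ((x + t)`!)%N%:R ((x + s)`!)%N%:R ((k.+1 + x + t)`!)%N%:R.
move: ((x + t + k)`!)%N%:R ((x + k)`!)%N%:R S%:R.
move=> u v S' c1 c2 fk fx fs fxt fxs fp fk0 fx0 fs0 fxt0 fxs0 fp0 c10 c20.
field.
by rewrite fk0 fx0 fs0 fxt0 fxs0 fp0 c10 c20.
Qed.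

(** The number [s] of points missed by both supports determines the size of their intersection by
    inclusion-exclusion. In these terms the cycle condition of [cyclic_pairs_meet] asks for [m - s]
    cycles. *)
Lemma cyclic_pairs_stirling (n m s : nat) (A B : {set 'I_n}) :
  #|~: (A :|: B)| = s -> (n < #|A| + #|B| + s)%N -> ~~ odd (m + #|A| + #|B| + n) ->
  (cyclic_pairs A B m)%:R
  = 2 * (#|A|.-1)`!%:R * (#|B|.-1)`!%:R
    * (stirling1 (#|A| + #|B| + s - n + 1) (m%:Z - s%:Z))%:R
    / ((#|A| + #|B| + s - n).+1)`!%:R :> rat.
Proof.
move=> ABs lt par.
have kE : #|A :&: B| = (#|A| + #|B| + s - n)%N.
  move: (cardsC (A :|: B)) (cardsUI A B); rewrite card_ord ABs => E1 E2.
  by clear -E1 E2; lia.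
have AB0 : A :&: B != set0 by rewrite -card_gt0 kE subn_gt0.
have := @cyclic_pairs_meet _ A B m AB0; rewrite card_ord kE => /(_ par) E.
apply: (canRL (mulfK _)).
  by rewrite Num.Theory.pnatr_eq0 -lt0n fact_gt0.
rewrite -!natrM E addn1; congr (_ * _)%N%:R; rewrite /stirling1.
apply: eq_card => g; rewrite !inE /num_cycles.
by move: #|porbits g| lt; clear; move: #|A| #|B| => u v w lt; apply/eqP/eqP; lia.
Qed.

(* The lower bound [j.+1 - (i + t)] is max(0, j - i - t + 1) by truncation; in
   the summation range i + t + s - j >= 1, and all other natural-number
   subtractions are exact as well. *)
Theorem theorem6p9 (i j t m : nat) (hi : (2 <= i)%N) (ht : (t <= j)%N)
    (hm : (1 <= m)%N) (hpar : ~~ odd (i + j + t + m)) :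
  (num_triples (i + j) m ((i + t)%N :: nseq (j - t) 1%N) (i :: nseq j 1%N))%:R
  = \sum_(j.+1 - (i + t) <= s < (j - t).+1)
      ((i + j)`!)%N%:R / (s`! * (i + t + s - j))%N%:R
      * 'C(i - 1, j - s - t)%N%:R * 'C(i + t - 1, j - s)%N%:R
      * ((stirling1 (i + t + s - j + 1) (m%:Z - s%:Z))%:R
         / 'C(i + t + s - j + 1, 2)%N%:R)
    + Lambda m i j t :> rat.
Proof.
set n := (i + j)%N; set p := (i + t)%N.
have nE : #|'I_n| = n by rewrite card_ord.
have cardC (A : {set 'I_n}) : #|~: A| = (n - #|A|)%N by rewrite cardsCs setCK nE.
have -> : (j - t = n - p)%N by rewrite /n /p; lia.
have -> : nseq j 1%N = nseq (n - i) 1%N by rewrite /n addKn.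
rewrite num_triples_pairs //; try by rewrite /n /p; lia.
(* For two supports missing [s] points, [v s] counts the pairs of cycles if the supports meet, [v0]
   if they are disjoint. For a fixed support [A] of the [p]-cycle, [w s] is the total over all such
   [B]. *)
pose v s : rat := 2 * (p.-1)`!%:R * (i.-1)`!%:R
    * (stirling1 (p + i + s - n + 1) (m%:Z - s%:Z))%:R / ((p + i + s - n).+1)`!%:R.
pose v0 : rat := ((p.-1)`! * (i.-1)`! * (m + p + i == n + 2))%N%:R.
pose w s : rat := if (p + i + s < n)%N then 0 else
  ('C(p, p + i + s - n) * 'C(n - p, s))%N%:R * (if (p + i + s == n)%N then v0 else v s).
have fiber (A : {set 'I_n}) s : #|A| = p -> (s < (n - p).+1)%N ->
    (\sum_(B : {set 'I_n} | (#|B| == i) && (#|~: (A :|: B)| == s)) cyclic_pairs A B m)%:R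
    = w s.
  move=> pA sn; have AC : #|~: A| = (n - p)%N by rewrite cardC pA.
  have := @card_sets_meet0 _ A i s; have := @card_sets_meet _ A i s (p + i + s - n).
  rewrite pA nE AC /w => cE c0; case: ltnP => [lt|le].
    have {}c0 := c0 lt; rewrite big_pred0 // => B.
    by have /setP/(_ B) := c0; rewrite !inE.
  have {}cE := cE (subnK le) sn; rewrite -cE -sum1_card natr_sum natr_sum mulr_suml.
  apply: eq_big => [B|B /andP [/eqP Bi /eqP ABs]]; first by rewrite inE.
  rewrite mul1r; case: eqP => [eqn|neqn].
    rewrite cyclic_pairs_disjoint ?nE ?pA ?Bi //.
    - by rewrite -card_gt0 pA /p; lia.
    - by rewrite -card_gt0 Bi; lia.
    apply/eqP; rewrite -cards_eq0.
    move: (cardsC (A :|: B)) (cardsUI A B); rewrite nE ABs pA Bi.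
    by clear -eqn; lia.
  rewrite (cyclic_pairs_stirling ABs) pA Bi //; first by rewrite ltn_neqAle le andbT; apply/eqP=> /esym.
  by move: hpar; rewrite /p /n !oddD; case: (odd i); case: (odd j); case: (odd t); case: (odd m).
have -> : (\sum_(A : {set 'I_n} | #|A| == p) \sum_(B : {set 'I_n} | #|B| == i) cyclic_pairs A B m)%N%:R
    = 'C(n, p)%:R * \sum_(0 <= s < (n - p).+1) w s.
  rewrite natr_sum (eq_bigr (fun=> \sum_(0 <= s < (n - p).+1) w s)) => [|A /eqP pA].
    rewrite sumr_const -[LHS]mulr_natl; congr (_%:R * _).
    rewrite -[n in RHS]nE -cardsT -cards_draws; apply: eq_card => A.
    by rewrite !inE subsetT.
  rewrite (@sum_fiber_nat _ _ (fun B => #|~: (A :|: B)|) (n - p).+1) => [|B _].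
    by rewrite natr_sum !big_mkord; apply: eq_bigr => s _; rewrite fiber.
  rewrite ltnS -pA -cardC; apply: subset_leq_card.
  by rewrite setCS subsetUl.
have termE s : (j.+1 - p <= s < (n - p).+1)%N ->
  'C(n, p)%:R * w s = n`!%:R / (s`! * (p + s - j))%N%:R
      * 'C(i - 1, j - s - t)%N%:R * 'C(p - 1, j - s)%N%:R
      * ((stirling1 (p + s - j + 1) (m%:Z - s%:Z))%:R / 'C(p + s - j + 1, 2)%N%:R).
  case/andP=> lo hi'.
  (* The supports share [k] points; [x] points of the [i]-cycle and [x + t] points of the [p]-cycle
     lie outside the other support. *)
  pose k := (p + s - j)%N; pose x := (j - s - t)%N.
  have k0 : (0 < k)%N by rewrite /k; clear -lo; lia.
  have iE : i = (k + x)%N by rewrite /k /x; move: lo hi'; rewrite /p /n; clear -hi ht; lia.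
  have jE : j = (x + s + t)%N by rewrite /x; move: hi'; rewrite /p /n; clear -ht; lia.
  have pE : p = (k + x + t)%N by rewrite /p iE.
  have n_p : (n - p = x + s)%N by rewrite /n pE iE jE; clear; lia.
  have kE : (p + i + s - n = k)%N by rewrite /n pE iE jE; clear; lia.
  rewrite /w ifF; last by rewrite /n pE iE jE; clear; apply/negbTE; lia.
  rewrite ifF; last by rewrite /n pE iE jE; clear -k0; apply/negbTE; lia.
  rewrite /v kE n_p -/x -/k.
  have -> : (j - s = x + t)%N by rewrite jE; clear; lia.
  rewrite /n; clearbody k x; clear -k0 iE jE pE; clearbody p; subst i j p.
  exact: meet_term.
rewrite mulr_sumr /Lambda -/n -/p.
(* Disjoint supports miss exactly [j - p] points, so they occur only if [p <= j]. *)
have [jp|pj] := ltnP j p.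
  have -> : (j.+1 - p = 0)%N by apply/eqP; rewrite subn_eq0.
  rewrite addr0; apply: eq_big_nat => s sn; apply: termE.
  by move: sn; rewrite (_ : j.+1 - p = 0)%N //; apply/eqP; rewrite subn_eq0.
have nj : (j.+1 - p <= (n - p).+1)%N by rewrite /n; clear; lia.
rewrite (big_cat_nat (n := j.+1 - p)) //= addrC; congr (_ + _).
  by apply: eq_big_nat => s sn; exact: termE.
(* Below [s = j - p] no pair of supports exists; the term at [j - p], with disjoint supports, is the
   [Lambda] term. *)
rewrite subSn // big_nat_recr //= big_nat big1 ?add0r => [|s /andP [_ sn]]; last first.
  by rewrite /w ifT ?mulr0 // /n; move: sn; clear; lia.
rewrite /w ifF; last by apply/negbTE; rewrite /n; clear -pj; lia.
have e : (p + i + (j - p) = n)%N by rewrite /n; clear -pj; lia.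
rewrite e eqxx subnn bin0 mul1n.
have -> : (m%:Z - j%:Z + i%:Z + t%:Z == 2) = (m + p + i == n + 2)%N.
  by rewrite /n /p; clear; apply/eqP/eqP; lia.
rewrite /v0 natrM mulrA mulrA; congr (_ * _).
have -> : (n - p = (j - p) + i)%N by rewrite -e; clear; lia.
have -> : n = (p + ((j - p) + i))%N by rewrite -e; clear; lia.
rewrite !natr_bin !natrM.
have p0 : (0 < p)%N by rewrite /p; clear -hi; lia.
have i0 : (0 < i)%N by exact: ltnW.
have fE l : (0 < l)%N -> (l`!%:R : rat) = l%:R * (l.-1)`!%:R.
  by case: l => // l _; rewrite factS natrM.
have f0 l : (l`!%:R : rat) != 0 by rewrite Num.Theory.pnatr_eq0 -lt0n fact_gt0.
have nz l : (0 < l)%N -> (l%:R : rat) != 0 by rewrite Num.Theory.pnatr_eq0 -lt0n.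
rewrite (fE p p0) (fE i i0).
field.
by rewrite !f0 !nz.
Qed.
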